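(* Let $\sigma>0$ and let $u_0\in L^2_+(\mathbb T)\cap G_{\sigma}(W)$. Let $u\in C(\mathbb R, H^{1/2}_+(\mathbb T))$ be the unique global solution of the cubic Szeg\H{o} equation $$i\partial_t u=\Pi(|u|^2u),\qquad (t,\theta)\in\mathbb R\times\mathbb T,\qquad u(0)=u_0.$$ Then there exist constants $\lambda>0$ and $C_0>0$, depending on $u_0$ (and $\sigma$), such that, setting $\tau(t)=\sigma e^{-\lambda|t|}$, one has $u(t)\in G_{\tau(t)}(W)$ for all $t\in\mathbb R$, and more precisely $$\|u(t)\|_{G_{\tau(t)}(W)}\le C_0\quad\text{for all } t\in\mathbb R.$$
   Context: $\mathbb T=\mathbb R/2\pi\mathbb Z$. For $u\in L^1(\mathbb T)$ write $u=\sum_{k\in\mathbb Z}\hat u(k)e^{ik\theta}$. The Hardy space is $L^2_+(\mathbb T)=\{u\in L^2(\mathbb T):\hat u(k)=0 \text{ for all } k<0\}$, and $H^s_+(\mathbb T)=H^s(\mathbb T)\cap L^2_+(\mathbb T)$. The Szeg\H{o} projector $\Pi:L^2(\mathbb T)\to L^2_+(\mathbb T)$ is $\Pi(\sum_{k\in\mathbb Z}v_ke^{ik\theta})=\sum_{k\ge0}v_ke^{ik\theta}$. For $\sigma\ge0$, the Gevrey norm is $\|u\|_{G_\sigma(W)}=\sum_{k\in\mathbb Z}e^{\sigma|k|}|\hat u(k)|$, and $G_\sigma(W)$ is the set of $u\in L^1(\mathbb T)$ with $\|u\|_{G_\sigma(W)}<\infty$ ($W=G_0(W)$ is the Wiener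 algebra). It is known (prior work) that for $u_0\in H^s_+(\mathbb T)$, $s\ge 1/2$, the cubic Szeg\H{o} equation has a unique solution $u\in C(\mathbb R,H^s_+(\mathbb T))$. *)

(* Defs.v *)
(* A function u in L^2_+(T) is represented by its nonnegative Fourier
   coefficients a : nat -> C (a k = \hat u(k), k >= 0; negative modes vanish). *)
From Stdlib Require Export Reals.
From Coquelicot Require Export Coquelicot.
Open Scope R_scope.

Definition in_Gevrey (s : R) (a : nat -> C) : Prop :=
  ex_series (fun k => exp (s * INR k) * Cmod (a k)).
Definition Gevrey_norm (s : R) (a : nat -> C) : R :=
  Series (fun k => exp (s * INR k) * Cmod (a k)).

Definition in_H12 (a : nat -> C) : Prop :=
  ex_series (fun k => (1 + INR k) * (Cmod (a k))^2).
Definition H12_norm_sq (a : nat -> C) : R :=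
  Series (fun k => (1 + INR k) * (Cmod (a k))^2).

(* k-th Fourier coefficient of Pi(|u|^2 u), k >= 0:
   sum over k1 - k2 + k3 = k (all >= 0) of a k1 * conj(a k2) * a k3
   = sum_{k2>=0} conj(a k2) * sum_{k1=0}^{k+k2} a k1 * a (k+k2-k1).
   (Absolutely convergent for a in H^{1/2}.) *)
Definition szego_term (a : nat -> C) (k k2 : nat) : C :=
  Cmult (Cconj (a k2))
        (sum_n (fun k1 => Cmult (a k1) (a (k + k2 - k1)%nat)) (k + k2)).

Definition szego_solution (u0 : nat -> C) (u : R -> nat -> C) : Prop :=
  u 0 = u0 /\
  (forall t, in_H12 (u t)) /\
  (forall t, is_lim (fun s => H12_norm_sq (fun k => Cminus (u s k) (u t k))) t 0) /\
  (forall (t : R) (k : nat), exists d : C,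
      is_derive (fun s => u s k) t d /\
      is_series (fun k2 => szego_term (u t) k k2) (Cmult Ci d)).

(* Main.v *)
(* The Hankel operator H_u = (u_{j+k}) of a solution satisfies a Lax equation
   H' = L H + H L^T with L skew-adjoint, so its trace norm is conserved; reading
   off the diagonals u_{2k} and u_{2k+1} bounds the Wiener norm of u(t) by a
   constant M for all times.  Given M, the excess E = sum_k (e^{tau k} - 1) |u_k|
   with tau = sigma e^{-lambda t} satisfies E' <= tau D (2 M (M + E) - lambda)
   where D = sum_k k e^{tau k} |u_k|, because e^{tau k} - 1 <= tau k e^{tau k};
   hence E does not increase once lambda >= 2 M (M + E(0)).

   A solution is only known to be in H^{1/2}, so one must first show that it
   remains analytic on bounded time intervals.  There, an energy estimate with
   the truncated weight min(1+k, K)^3 loses only a factor K^{ct}, since the l^1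
   norm of the first n modes is at most sqrt(log n) times the H^{1/2} norm; for
   short times this still leaves |u_k| = O(k^{-2}), and the Gevrey estimate
   above restarts the argument. *)
Require Import Defs.
From Stdlib Require Import Reals Lra Lia Psatz Arith ClassicalEpsilon.
From Coquelicot Require Import Coquelicot.
Open Scope R_scope.

(** * Finite sums *)

(** The controlled quantities, weighted l^1 norms and a trace norm, need not be differentiable in
    time, and the infinite sums are not known in advance to be finite. So every bound is put on
    partial sums, uniformly in their length, and time is discretised: one explicit Euler step
    changes the quantity by its rate times h plus O(h^2), and refining the step removes the
    remainder. Constants in front of h^2 may therefore depend badly on a frequency cap.

    For the trace norm the Euler step is a congruence by I + hL, whose norm is 1 + O(h^2) because L
    is skew-adjoint. Cutting to N modes spoils the Lax equation by O(1/N). This is measured with a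
    weighted bound A on [0,T], supplied by analyticity on compact intervals; A enters only the
    errors and disappears in the limit, so the Wiener bound depends on u_0 alone. At time 0 the
    trace norm is finite because u_{j+k} = O((1+j)^{-2} (1+k)^{-2}).

    Negative times follow from t -> -t combined with conjugation of the coefficients. *)

Fixpoint Sum (n : nat) (f : nat -> R) : R :=
  match n with O => 0 | S m => Sum m f + f m end.

Lemma Sum_ext n f g : (forall i, (i < n)%nat -> f i = g i) -> Sum n f = Sum n g.
Proof.
  induction n as [|n IH]; simpl; intros H; [reflexivity|].
  rewrite IH, H; auto with arith.
Qed.

Lemma Sum_le n f g : (forall i, (i < n)%nat -> f i <= g i) -> Sum n f <= Sum n g.
Proof.
  induction n as [|n IH]; simpl; intros H; [lra|].
  apply Rplus_le_compat; auto with arith.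
Qed.

Lemma Sum_zero n : Sum n (fun _ => 0) = 0.
Proof. induction n; simpl; lra. Qed.

Lemma Sum_nonneg n f : (forall i, (i < n)%nat -> 0 <= f i) -> 0 <= Sum n f.
Proof. intros H. rewrite <- (Sum_zero n). now apply Sum_le. Qed.

Lemma Sum_plus n f g : Sum n (fun i => f i + g i) = Sum n f + Sum n g.
Proof. induction n; simpl; lra. Qed.

Lemma Sum_scal n c f : Sum n (fun i => c * f i) = c * Sum n f.
Proof. induction n as [|n IH]; simpl; [|rewrite IH]; ring. Qed.

Lemma Sum_minus n f g : Sum n (fun i => f i - g i) = Sum n f - Sum n g.
Proof. induction n; simpl; lra. Qed.

Lemma Sum_swap n m f :
  Sum n (fun i => Sum m (fun j => f i j)) = Sum m (fun j => Sum n (fun i => f i j)).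
Proof.
  induction n as [|n IH]; simpl.
  - now rewrite Sum_zero.
  - now rewrite IH, Sum_plus.
Qed.

Lemma Sum_le_size n m f :
  (n <= m)%nat -> (forall i, 0 <= f i) -> Sum n f <= Sum m f.
Proof.
  intros H Hf. induction H; simpl; [lra|]. specialize (Hf m); lra.
Qed.

Lemma Sum_term n f i : (forall j, 0 <= f j) -> (i < n)%nat -> f i <= Sum n f.
Proof.
  intros Hf Hi. apply Rle_trans with (Sum (S i) f).
  - simpl. pose proof (Sum_nonneg i f (fun j _ => Hf j)). lra.
  - now apply Sum_le_size.
Qed.

Lemma Sum_const n c : Sum n (fun _ => c) = INR n * c.
Proof. induction n as [|n IH]; simpl Sum; [simpl|rewrite IH, S_INR]; ring. Qed.

(** Used for resonance conditions: once three frequencies are fixed, at most one value of the fourth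
    satisfies them, so summing over it costs nothing. *)
Lemma Sum_single_le n (b : nat -> bool) c :
  0 <= c -> (forall i j, b i = true -> b j = true -> i = j) ->
  Sum n (fun i => if b i then c else 0) <= c.
Proof.
  intros Hc Hb. induction n as [|n IH]; simpl; [lra|].
  destruct (b n) eqn:E; [|lra].
  rewrite (Sum_ext n _ (fun _ => 0)); [rewrite Sum_zero; lra|].
  intros i Hi. destruct (b i) eqn:Ei; [|reflexivity].
  specialize (Hb _ _ E Ei); lia.
Qed.

Lemma Sum_triple_prod J a b c :
  Sum J (fun i => Sum J (fun j => Sum J (fun l => a i * (b j * c l)))) =
  Sum J a * (Sum J b * Sum J c).
Proof.
  transitivity (Sum J (fun i => (Sum J b * Sum J c) * a i)); [|rewrite Sum_scal; ring].
  apply Sum_ext; intros i _.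
  transitivity (Sum J (fun j => (a i * Sum J c) * b j)); [|rewrite Sum_scal; ring].
  apply Sum_ext; intros j _. rewrite !Sum_scal. ring.
Qed.

Lemma Sum_amgm n f g s : 0 < s ->
  Sum n (fun i => f i * g i) <= / 2 * (s * Sum n (fun i => f i ^ 2) + / s * Sum n (fun i => g i ^ 2)).
Proof.
  intros Hs. rewrite <- !Sum_scal, <- Sum_plus, <- Sum_scal.
  apply Sum_le; intros i _.
  assert (0 <= / s * (s * f i - g i) ^ 2).
  { apply Rmult_le_pos; [left; now apply Rinv_0_lt_compat|apply pow2_ge_0]. }
  replace (/ s * (s * f i - g i) ^ 2) with
    (s * f i ^ 2 + / s * g i ^ 2 - 2 * (f i * g i)) in H by (field; lra).
  lra.
Qed.

Lemma Sum_sqr_nonneg n f : 0 <= Sum n (fun i => f i ^ 2).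
Proof. apply Sum_nonneg; intros; apply pow2_ge_0. Qed.

Lemma Sum_cauchy_schwarz n f g a b : 0 <= a -> 0 <= b ->
  Sum n (fun i => f i ^ 2) <= a ^ 2 -> Sum n (fun i => g i ^ 2) <= b ^ 2 ->
  Sum n (fun i => f i * g i) <= a * b.
Proof.
  intros Ha Hb Hf Hg. apply le_epsilon; intros e He.
  (* Shifting both bounds by [r] keeps the ratio in the weighted AM-GM inequality finite and
     positive when [a] or [b] vanishes; the price r (a + b) / 2 is below [e]. *)
  set (r := e / (1 + a + b)).
  assert (Hr : 0 < r) by (apply Rdiv_lt_0_compat; lra).
  assert (Her : r * (1 + a + b) = e) by (unfold r; field; lra).
  pose proof (Sum_amgm n f g ((b + r) / (a + r)) ltac:(apply Rdiv_lt_0_compat; lra)).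
    assert (Hx : (b + r) / (a + r) * Sum n (fun i => f i ^ 2) <= a * (b + r)).
    { apply Rle_trans with ((b + r) / (a + r) * (a * (a + r))).
      - apply Rmult_le_compat_l; [|nra]. left; apply Rdiv_lt_0_compat; lra.
      - right; field; lra. }
    assert (Hy : / ((b + r) / (a + r)) * Sum n (fun i => g i ^ 2) <= b * (a + r)).
    { apply Rle_trans with (/ ((b + r) / (a + r)) * (b * (b + r))).
      - apply Rmult_le_compat_l; [|nra]. left; apply Rinv_0_lt_compat, Rdiv_lt_0_compat; lra.
      - right; field; lra. }
    nra.
Qed.

Lemma Sum_sqr_le n f : (forall i, 0 <= f i) ->
  Sum n (fun i => f i ^ 2) <= (Sum n f) ^ 2.
Proof.
  intros Hf. induction n as [|n IH]; cbn [Sum]; [simpl; lra|].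
  pose proof (Rmult_le_pos _ _ (Sum_nonneg n f (fun i _ => Hf i)) (Hf n)). lra.
Qed.

Definition inv2 (k : nat) : R := / (1 + INR k) ^ 2.

Lemma INR1_pos k : 0 < 1 + INR k.
Proof. pose proof (pos_INR k); lra. Qed.

Lemma inv2_pos k : 0 < inv2 k.
Proof. apply Rinv_0_lt_compat, pow_lt, INR1_pos. Qed.

Lemma inv2_le k : (1 <= k)%nat -> inv2 k <= / INR k - / INR (S k).
Proof.
  intros H. apply le_INR in H; simpl INR in H. rewrite S_INR. unfold inv2.
  assert (E : / INR k - / (INR k + 1) = / (INR k * (INR k + 1))) by (field; lra).
  rewrite E. apply Rinv_le_contravar; nra.
Qed.

Lemma Sum_inv2 n : Sum n inv2 <= 2.
Proof.
  assert (H : forall n, Sum (S n) inv2 <= 2 - / INR (S n)).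
  { induction n0 as [|m IH].
    - unfold inv2; simpl; lra.
    - change (Sum (S (S m)) inv2) with (Sum (S m) inv2 + inv2 (S m)).
      pose proof (inv2_le (S m) ltac:(lia)). lra. }
  destruct n as [|n]; [simpl; lra|].
  specialize (H n). pose proof (Rinv_0_lt_compat _ (lt_0_INR (S n) ltac:(lia))). lra.
Qed.

Lemma Sum_inv2_tail J n : (1 <= n)%nat ->
  Sum J (fun k => if Nat.leb n k then inv2 k else 0) <= / INR n.
Proof.
  intros Hn.
  assert (P : forall j, (1 <= j)%nat -> 0 < / INR j)
    by (intros; apply Rinv_0_lt_compat, lt_0_INR; lia).
  assert (H : Sum J (fun k => if Nat.leb n k then inv2 k else 0) <= / INR n - / INR (max n J)).
  { induction J as [|J IH]; [rewrite Nat.max_l by lia; simpl; lra|].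
    cbn [Sum]. destruct (Nat.leb_spec n J).
    - rewrite Nat.max_r in * by lia. pose proof (inv2_le J ltac:(lia)). lra.
    - rewrite Nat.max_l in * by lia. lra. }
  specialize (P (max n J) ltac:(lia)). lra.
Qed.

Lemma Sum_harmonic n : (1 <= n)%nat -> Sum n (fun k => / (1 + INR k)) <= 1 + ln (INR n).
Proof.
  induction n as [|n IH]; [lia|]. intros _. cbn [Sum].
  destruct n as [|n]; [simpl; rewrite ln_1; lra|].
  specialize (IH ltac:(lia)).
  assert (Hp : 0 < INR (S n)) by (apply lt_0_INR; lia).
  assert (/ (1 + INR (S n)) <= ln (INR (S (S n))) - ln (INR (S n))); [|lra].
  rewrite (S_INR (S n)). set (y := INR (S n)) in *.
  (* [ln (y/(y+1)) <= y/(y+1) - 1] *)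
  pose proof (exp_ineq1_le (ln (y / (y + 1)))) as E.
  rewrite exp_ln in E by (apply Rdiv_lt_0_compat; lra).
  rewrite ln_div in E by lra.
  replace (/ (1 + y)) with (1 - y / (y + 1)) by (field; lra). lra.
Qed.

(** * Resonant sums and the cubic nonlinearity *)

Definition Sum4 (J : nat) (F : nat -> nat -> nat -> nat -> R) : R :=
  Sum J (fun k => Sum J (fun p => Sum J (fun q => Sum J (fun r => F k p q r)))).

Lemma Sum4_swap12 J F : Sum4 J F = Sum4 J (fun k p q r => F p k q r).
Proof. unfold Sum4. now rewrite Sum_swap. Qed.

Lemma Sum4_swap23 J F : Sum4 J F = Sum4 J (fun k p q r => F k q p r).
Proof. unfold Sum4. apply Sum_ext; intros k _. now rewrite Sum_swap. Qed.

Lemma Sum4_swap34 J F : Sum4 J F = Sum4 J (fun k p q r => F k p r q).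
Proof.
  unfold Sum4. apply Sum_ext; intros k _. apply Sum_ext; intros p _.
  now rewrite Sum_swap.
Qed.

Lemma Sum4_le J F G : (forall k p q r, F k p q r <= G k p q r) -> Sum4 J F <= Sum4 J G.
Proof. intros H. unfold Sum4. do 4 (apply Sum_le; intros ? _). apply H. Qed.

Lemma Sum4_ext J F G : (forall k p q r, F k p q r = G k p q r) -> Sum4 J F = Sum4 J G.
Proof. intros H. unfold Sum4. do 4 (apply Sum_ext; intros ? _). apply H. Qed.

(* The quadrilinear sums [F k p q r] over the resonances [k - p + q - r = 0]
   produced by pairing mode [k] with the cubic term [u_p conj(u_q) u_r]. *)
Definition Q4 (J : nat) (F : nat -> nat -> nat -> nat -> R) : R :=
  Sum4 J (fun k p q r => if Nat.eqb (k + q) (p + r) then F k p q r else 0).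

Lemma Q4_le J F G :
  (forall k p q r, (k + q = p + r)%nat -> F k p q r <= G k p q r) -> Q4 J F <= Q4 J G.
Proof.
  intros H. apply Sum4_le; intros. destruct (Nat.eqb_spec (k + q) (p + r)); [auto|lra].
Qed.

Lemma Q4_plus J F G :
  Q4 J (fun k p q r => F k p q r + G k p q r) = Q4 J F + Q4 J G.
Proof.
  unfold Q4, Sum4. rewrite <- Sum_plus. apply Sum_ext; intros k _.
  rewrite <- Sum_plus. apply Sum_ext; intros p _.
  rewrite <- Sum_plus. apply Sum_ext; intros q _.
  rewrite <- Sum_plus. apply Sum_ext; intros r _.
  destruct (Nat.eqb _ _); lra.
Qed.

Lemma Q4_scal J c F : Q4 J (fun k p q r => c * F k p q r) = c * Q4 J F.
Proof.
  unfold Q4, Sum4. rewrite <- Sum_scal. apply Sum_ext; intros k _.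
  rewrite <- Sum_scal. apply Sum_ext; intros p _.
  rewrite <- Sum_scal. apply Sum_ext; intros q _.
  rewrite <- Sum_scal. apply Sum_ext; intros r _.
  destruct (Nat.eqb _ _); lra.
Qed.

Lemma Q4_sym_pr J F : Q4 J F = Q4 J (fun k p q r => F k r q p).
Proof.
  unfold Q4. rewrite Sum4_swap34, Sum4_swap23, Sum4_swap34.
  apply Sum4_ext; intros. now rewrite (Nat.add_comm r p).
Qed.

Lemma Q4_sym_kq J F : Q4 J F = Q4 J (fun k p q r => F q p k r).
Proof.
  unfold Q4. rewrite Sum4_swap12, Sum4_swap23, Sum4_swap12.
  apply Sum4_ext; intros. now rewrite (Nat.add_comm q k).
Qed.

Lemma Q4_sym_sides J F : Q4 J F = Q4 J (fun k p q r => F p k r q).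
Proof.
  unfold Q4. rewrite Sum4_swap12, Sum4_swap34.
  apply Sum4_ext; intros. now rewrite (Nat.eqb_sym (p + r)).
Qed.

Section Omit.
Variables (J : nat) (a b c : nat -> R) (A B D : R).
Hypotheses (Ha : forall i, 0 <= a i) (Hb : forall i, 0 <= b i) (Hc : forall i, 0 <= c i).
Hypotheses (HA : Sum J a <= A) (HB : Sum J b <= B) (HD : Sum J c <= D).

(** A discrete Young inequality: the frequency absent from the summand is fixed by the resonance, so
    the sum is at most a product of three l^1 norms. The variants follow from the symmetries of k +
    q = p + r. *)
Lemma Q4_omit_r : Q4 J (fun k p q _ => a k * (b p * c q)) <= A * (B * D).
Proof.
  apply Rle_trans with (Sum J a * (Sum J b * Sum J c)).
  - rewrite <- Sum_triple_prod. unfold Q4, Sum4.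
    do 3 (apply Sum_le; intros ? _). apply Sum_single_le.
    + repeat apply Rmult_le_pos; auto.
    + intros r r'. rewrite !Nat.eqb_eq. lia.
  - pose proof (Sum_nonneg J a (fun i _ => Ha i)). pose proof (Sum_nonneg J b (fun i _ => Hb i)).
    pose proof (Sum_nonneg J c (fun i _ => Hc i)).
    apply Rmult_le_compat; auto using Rmult_le_pos. apply Rmult_le_compat; auto.
Qed.

Lemma Q4_omit_p : Q4 J (fun k _ q r => a k * (b r * c q)) <= A * (B * D).
Proof. rewrite Q4_sym_pr. apply Q4_omit_r. Qed.

Lemma Q4_omit_q : Q4 J (fun k p _ r => a p * (b k * c r)) <= A * (B * D).
Proof. rewrite Q4_sym_sides. apply Q4_omit_r. Qed.

Lemma Q4_omit_k : Q4 J (fun _ p q r => a p * (b q * c r)) <= A * (B * D).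
Proof. rewrite Q4_sym_kq. apply Q4_omit_q. Qed.
End Omit.

(** * Complex finite sums and truncations of the cubic term *)

Fixpoint CSum (n : nat) (f : nat -> C) : C :=
  match n with O => RtoC 0 | S m => Cplus (CSum m f) (f m) end.

Lemma CSum_ext n f g : (forall i, (i < n)%nat -> f i = g i) -> CSum n f = CSum n g.
Proof.
  induction n as [|n IH]; simpl; intros H; [reflexivity|].
  rewrite IH, H; auto with arith.
Qed.

Lemma CSum_zero n : CSum n (fun _ => RtoC 0) = RtoC 0.
Proof. induction n as [|n IH]; simpl; [|rewrite IH; ring]; reflexivity. Qed.

Lemma CSum_plus n f g : CSum n (fun i => Cplus (f i) (g i)) = Cplus (CSum n f) (CSum n g).
Proof. induction n as [|n IH]; simpl; [|rewrite IH]; ring. Qed.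

Lemma CSum_scal n c f : CSum n (fun i => Cmult c (f i)) = Cmult c (CSum n f).
Proof. induction n as [|n IH]; simpl; [|rewrite IH]; ring. Qed.

Lemma CSum_minus n f g : CSum n (fun i => Cminus (f i) (g i)) = Cminus (CSum n f) (CSum n g).
Proof. induction n as [|n IH]; simpl; [|rewrite IH]; ring. Qed.

Lemma CSum_swap n m f :
  CSum n (fun i => CSum m (fun j => f i j)) = CSum m (fun j => CSum n (fun i => f i j)).
Proof.
  induction n as [|n IH]; simpl.
  - now rewrite CSum_zero.
  - now rewrite IH, CSum_plus.
Qed.

Lemma Cmod_CSum n f : Cmod (CSum n f) <= Sum n (fun i => Cmod (f i)).
Proof.
  induction n as [|n IH]; simpl; [rewrite Cmod_0; lra|].
  eapply Rle_trans; [apply Cmod_triangle|lra].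
Qed.

Lemma CSum_pad n m f : (n <= m)%nat -> (forall i, (n <= i)%nat -> f i = RtoC 0) ->
  CSum m f = CSum n f.
Proof.
  intros H Hf. induction H as [|m Hm IH]; [reflexivity|].
  simpl. rewrite IH, Hf by assumption. ring.
Qed.

Lemma CSum_delta L m p z : (m < L)%nat ->
  CSum L (fun r => if Nat.eqb m (p + r) then z r else RtoC 0) =
  if Nat.leb p m then z (m - p)%nat else RtoC 0.
Proof.
  intros HL. destruct (Nat.leb_spec p m).
  - rewrite (CSum_pad (S (m - p))) by
      (lia || (intros i Hi; destruct (Nat.eqb_spec m (p + i)); [lia|reflexivity])).
    simpl. rewrite (CSum_ext _ _ (fun _ => RtoC 0)), CSum_zero.
    + replace (p + (m - p))%nat with m by lia. rewrite Nat.eqb_refl. ring.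
    + intros i Hi. destruct (Nat.eqb_spec m (p + i)); [lia|reflexivity].
  - rewrite (CSum_ext _ _ (fun _ => RtoC 0)), CSum_zero; [reflexivity|].
    intros i Hi. destruct (Nat.eqb_spec m (p + i)); [lia|reflexivity].
Qed.

Lemma CSum_sum_n (f : nat -> C) n : sum_n f n = CSum (S n) f.
Proof.
  induction n as [|n IH].
  - rewrite sum_O. change (@eq C (f O) (Cplus (RtoC 0) (f O))). ring.
  - rewrite sum_Sn, IH. reflexivity.
Qed.

Definition cubic (a : nat -> C) (p q r : nat) : C :=
  Cmult (Cmult (a p) (Cconj (a q))) (a r).

Definition rect (J L : nat) (a : nat -> C) (k : nat) : C :=
  CSum J (fun q => CSum L (fun p => CSum L (fun r =>
    if Nat.eqb (k + q) (p + r) then cubic a p q r else RtoC 0))).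

(** For q <= n the resonance p + r = k + q already forces p and r below [L], so the box loses no
    term. The sum over [q] is cut separately because it is the one that the series in the equation
    runs over. *)
Lemma szego_partial_sum a k n L : (k + n < L)%nat ->
  sum_n (szego_term a k) n = rect (S n) L a k.
Proof.
  intros HL. rewrite CSum_sum_n. apply CSum_ext; intros q Hq.
  unfold szego_term. rewrite CSum_sum_n, <- CSum_scal.
  rewrite <- (CSum_ext L (fun p => if Nat.leb p (k + q)
    then Cmult (Cconj (a q)) (Cmult (a p) (a (k + q - p)%nat)) else RtoC 0)).
  - symmetry. rewrite (CSum_pad (S (k + q)) L).
    + apply CSum_ext; intros p Hp. destruct (Nat.leb_spec p (k + q)); [reflexivity|lia].
    + lia.
    + intros p Hp. destruct (Nat.leb_spec p (k + q)); [lia|reflexivity].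
  - intros p Hp. rewrite CSum_delta by lia.
    destruct (Nat.leb p (k + q)); [unfold cubic; ring|reflexivity].
Qed.

Lemma rect_diff J L u v F k : (J <= L)%nat ->
  (forall p q r, Cmod (Cminus (cubic u p q r) (cubic v p q r)) <= F p q r) ->
  Cmod (Cminus (rect J L u k) (rect J L v k)) <=
  Sum L (fun p => Sum L (fun q => Sum L (fun r =>
    if Nat.eqb (k + q) (p + r) then F p q r else 0))).
Proof.
  intros HJ HF. rewrite Sum_swap.
  assert (HF0 : forall p q r, 0 <= F p q r)
    by (intros; eapply Rle_trans; [apply Cmod_ge_0|apply HF]).
  apply Rle_trans with (Sum J (fun q => Sum L (fun p => Sum L (fun r =>
    if Nat.eqb (k + q) (p + r) then F p q r else 0)))).
  - unfold rect. rewrite <- CSum_minus.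
    eapply Rle_trans; [apply Cmod_CSum|]. apply Sum_le; intros q _.
    rewrite <- CSum_minus.
    eapply Rle_trans; [apply Cmod_CSum|]. apply Sum_le; intros p _.
    rewrite <- CSum_minus.
    eapply Rle_trans; [apply Cmod_CSum|]. apply Sum_le; intros r _.
    destruct (Nat.eqb _ _); [apply HF|].
    replace (Cminus _ _) with (RtoC 0) by ring. rewrite Cmod_0; lra.
  - apply Sum_le_size; [assumption|]. intros q.
    do 2 (apply Sum_nonneg; intros ? _). destruct (Nat.eqb _ _); [apply HF0|lra].
Qed.

Lemma is_lim_seq_Sum m (f : nat -> nat -> R) (l : nat -> R) :
  (forall k, (k < m)%nat -> is_lim_seq (fun n => f n k) (l k)) ->
  is_lim_seq (fun n => Sum m (f n)) (Sum m l).
Proof.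
  induction m as [|m IH]; simpl; intros H; [apply is_lim_seq_const|].
  apply is_lim_seq_plus'; [apply IH; intros; apply H; lia|apply H; lia].
Qed.

Lemma is_series_Cmod_diff (f g : nat -> C) (l l' : C) :
  is_series f l -> is_series g l' ->
  is_lim_seq (fun n => Cmod (Cminus (sum_n f n) (sum_n g n))) (Cmod (Cminus l l')).
Proof.
  intros Hf Hg.
  assert (H : filterlim (fun n => norm (minus (sum_n f n) (sum_n g n))) eventually
                (locally (norm (minus l l')))).
  { refine (filterlim_comp _ _ _ _ norm _ _ _ _ (filterlim_norm _)).
    refine (filterlim_comp_2 _ _ plus Hf
      (filterlim_comp _ _ _ _ opp _ _ _ Hg (filterlim_opp _)) (filterlim_plus _ _)). }
  exact H.
Qed.

(** The single gateway from the equation to resonant sums: a bound uniform in [J] on finite boxes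
    passes to the limit of the partial sums. Taking [v] to be zero gives the size of the
    nonlinearity, another time gives its Lipschitz constant, and a truncation of [u] gives the
    cut-off error. *)
Lemma cubic_compare u v l l' c F B m :
  (forall k, 0 <= c k) ->
  (forall k, (k < m)%nat -> is_series (szego_term u k) (l k)) ->
  (forall k, (k < m)%nat -> is_series (szego_term v k) (l' k)) ->
  (forall p q r, Cmod (Cminus (cubic u p q r) (cubic v p q r)) <= F p q r) ->
  (forall J, Q4 J (fun k p q r => c k * F p q r) <= B) ->
  Sum m (fun k => c k * Cmod (Cminus (l k) (l' k))) <= B.
Proof.
  intros Hc Hu Hv HF HB.
  assert (HF0 : forall p q r, 0 <= F p q r)
    by (intros; eapply Rle_trans; [apply Cmod_ge_0|apply HF]).
  set (f := fun n k => c k * Cmod (Cminus (sum_n (szego_term u k) n) (sum_n (szego_term v k) n))).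
  assert (Hlim : is_lim_seq (fun n => Sum m (f n))
            (Sum m (fun k => c k * Cmod (Cminus (l k) (l' k))))).
  { apply is_lim_seq_Sum. intros k Hk. unfold f.
    apply (is_lim_seq_scal_l _ (c k) (Cmod _)).
    now apply is_series_Cmod_diff; [apply Hu|apply Hv]. }
  apply (is_lim_seq_le _ (fun _ => B) _ B) with (2 := Hlim) (3 := is_lim_seq_const B).
  (* One cube containing the output modes k < m as well as all p, q, r met by the partial sums up to
     [n]. *)
  intros n. set (L := (m + S n)%nat).
  apply Rle_trans with (2 := HB L). unfold Q4, Sum4.
  apply Rle_trans with (Sum m (fun k => Sum L (fun p => Sum L (fun q => Sum L (fun r =>
    if Nat.eqb (k + q) (p + r) then c k * F p q r else 0))))).
  - apply Sum_le; intros k Hk. unfold f.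
    rewrite !(szego_partial_sum _ k n L) by (unfold L; lia).
    eapply Rle_trans; [apply Rmult_le_compat_l; [apply Hc|]|].
    + apply rect_diff with (F := F); [unfold L; lia|exact HF].
    + rewrite <- Sum_scal. apply Sum_le; intros p _.
      rewrite <- Sum_scal. apply Sum_le; intros q _.
      rewrite <- Sum_scal. apply Sum_le; intros r _.
      destruct (Nat.eqb _ _); lra.
  - apply Sum_le_size; [unfold L; lia|]. intros k.
    do 3 (apply Sum_nonneg; intros ? _).
    destruct (Nat.eqb _ _); [apply Rmult_le_pos; auto|lra].
Qed.

(** * Solutions and their first-order expansion *)

Lemma sum_n_Sum (f : nat -> R) n : sum_n f n = Sum (S n) f.
Proof.
  induction n as [|n IH]; [rewrite sum_O; simpl; ring|].
  rewrite sum_Sn, IH. reflexivity.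
Qed.

Lemma Sum_le_Series f m : (forall k, 0 <= f k) -> ex_series f -> Sum m f <= Series f.
Proof.
  intros Hf [l Hl]. rewrite (is_series_unique _ _ Hl).
  apply Rle_trans with (Sum (S m) f); [apply Sum_le_size; auto|].
  rewrite <- sum_n_Sum.
  apply (is_lim_seq_incr_compare (sum_n f) l Hl).
  intros n. rewrite sum_Sn. unfold plus; simpl. specialize (Hf (S n)). lra.
Qed.

Lemma series_of_bounded f B : (forall k, 0 <= f k) -> (forall m, Sum m f <= B) ->
  ex_series f /\ Series f <= B.
Proof.
  intros Hf HB.
  assert (E : ex_finite_lim_seq (sum_n f)).
  { apply ex_finite_lim_seq_incr with B.
    - intros n. rewrite sum_Sn. unfold plus; simpl. specialize (Hf (S n)). lra.
    - intros n. rewrite sum_n_Sum. apply HB. }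
  destruct E as [l Hl]. split; [now exists l|].
  rewrite (is_series_unique f l Hl).
  apply (is_lim_seq_le (sum_n f) (fun _ => B) l B); [|exact Hl|apply is_lim_seq_const].
  intros n. rewrite sum_n_Sum. apply HB.
Qed.

(** Real and imaginary parts are kept apart so that the real mean value theorem applies to each. *)
Definition Cderive (f : R -> C) (t : R) (l : C) : Prop :=
  is_derive (fun s => fst (f s)) t (fst l) /\ is_derive (fun s => snd (f s)) t (snd l).

Lemma is_derive_Cderive (f : R -> C) (t : R) (l : C) : is_derive f t l -> Cderive f t l.
Proof.
  intros H. split.
  - exact (filterdiff_comp' f fst t (fun y => scal y l) fst H
      (filterdiff_linear _ is_linear_fst)).
  - exact (filterdiff_comp' f snd t (fun y => scal y l) snd H
      (filterdiff_linear _ is_linear_snd)).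
Qed.

Lemma is_derive_comp_affine (f : R -> R) a e t l :
  is_derive f (a + e * t) l -> is_derive (fun s => f (a + e * s)) t (e * l).
Proof.
  intros H. apply (is_derive_comp f (fun s => a + e * s) t l e H).
  auto_derive; auto; ring.
Qed.

Definition H12_le (a : nat -> C) (b : R) : Prop :=
  forall m, Sum m (fun k => (1 + INR k) * Cmod (a k) ^ 2) <= b.

(* Solutions with a chosen time derivative [d]; continuity in [H^{1/2}] is only
   used through the local boundedness of the norm. *)
Definition flow (u d : R -> nat -> C) : Prop :=
  (forall t, exists e b, 0 < e /\ forall s, Rabs (s - t) < e -> H12_le (u s) b) /\
  (forall t k, Cderive (fun s => u s k) t (d t k)) /\
  (forall t k, is_series (szego_term (u t) k) (Cmult Ci (d t k))).

Lemma H12_term_nonneg (a : nat -> C) k : 0 <= (1 + INR k) * Cmod (a k) ^ 2.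
Proof. apply Rmult_le_pos; [left; apply INR1_pos|apply pow2_ge_0]. Qed.

Lemma H12_term_triangle (a b : nat -> C) k :
  (1 + INR k) * Cmod (a k) ^ 2 <=
  2 * ((1 + INR k) * Cmod (Cminus (a k) (b k)) ^ 2) + 2 * ((1 + INR k) * Cmod (b k) ^ 2).
Proof.
  pose proof (INR1_pos k).
  assert (T : Cmod (a k) <= Cmod (Cminus (a k) (b k)) + Cmod (b k)).
  { replace (a k) with (Cplus (Cminus (a k) (b k)) (b k)) at 1 by ring. apply Cmod_triangle. }
  pose proof (Cmod_ge_0 (a k)).
  assert (Cmod (a k) ^ 2 <= 2 * Cmod (Cminus (a k) (b k)) ^ 2 + 2 * Cmod (b k) ^ 2).
  { apply Rle_trans with ((Cmod (Cminus (a k) (b k)) + Cmod (b k)) ^ 2).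
    - apply pow_incr; lra.
    - pose proof (pow2_ge_0 (Cmod (Cminus (a k) (b k)) - Cmod (b k))). nra. }
  nra.
Qed.

Lemma solution_flow u0 u : szego_solution u0 u -> exists d, flow u d.
Proof.
  intros (_ & Hin & Hcont & Hder).
  set (P := fun t k d => is_derive (fun s => u s k) t d /\
                         is_series (szego_term (u t) k) (Cmult Ci d)).
  exists (fun t k => proj1_sig (constructive_indefinite_description (P t k) (Hder t k))).
  split; [|split; intros t k;
    destruct (proj2_sig (constructive_indefinite_description (P t k) (Hder t k)));
    [now apply is_derive_Cderive|assumption]].
  intros t. specialize (Hcont t). apply is_lim_spec in Hcont.
  destruct (Hcont (mkposreal 1 Rlt_0_1)) as [e He]. simpl in He.
  set (b := H12_norm_sq (u t)).
  assert (Hb : H12_le (u t) b)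
    by (intros m; apply Sum_le_Series; [apply H12_term_nonneg|apply Hin]).
  assert (Hb0 : 0 <= b) by (apply (Hb O)).
  exists e, (2 * 1 + 2 * b). split; [apply cond_pos|]. intros s Hs m.
  (* [is_lim] says nothing about the point [t] itself, so s = t is treated apart. *)
  destruct (Req_dec s t) as [->|Hst]; [specialize (Hb m); lra|].
  specialize (He s Hs Hst).
  assert (Hd : Sum m (fun k => (1 + INR k) * Cmod (Cminus (u s k) (u t k)) ^ 2) <= 1).
  { eapply Rle_trans; [apply Sum_le_Series|].
    - intros k. apply (H12_term_nonneg (fun k => Cminus (u s k) (u t k))).
    (* [Series] has a default value on divergent series, so the limit hypothesis controls partial
       sums only after the difference is shown summable; this comes from both states lying in
       H^{1/2}. *)
    - apply (series_of_bounded _ (2 * H12_norm_sq (u s) + 2 * b));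
        [intros k; apply (H12_term_nonneg (fun k => Cminus (u s k) (u t k)))|].
      intros n. eapply Rle_trans.
      + apply Sum_le; intros k _.
        apply (H12_term_triangle (fun k => Cminus (u s k) (u t k)) (fun k => Copp (u t k)) k).
      + rewrite Sum_plus, !Sum_scal.
        apply Rplus_le_compat; apply Rmult_le_compat_l; try lra.
        * erewrite Sum_ext; [apply Sum_le_Series; [apply (H12_term_nonneg (u s))|apply Hin]|].
          intros k _. cbv beta. do 3 f_equal. ring.
        * erewrite Sum_ext; [apply (Hb n)|]. intros k _. cbv beta. now rewrite Cmod_opp.
    - apply Rabs_lt_between in He. unfold H12_norm_sq in He. lra. }
  eapply Rle_trans.
  - apply Sum_le; intros k _. apply (H12_term_triangle (u s) (u t) k).
  - rewrite Sum_plus, !Sum_scal. specialize (Hb m). lra.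
Qed.

Lemma flow_shift u d a : flow u d -> flow (fun t => u (a + t)) (fun t => d (a + t)).
Proof.
  intros (H1 & H2 & H3). split; [|split; auto].
  - intros t. destruct (H1 (a + t)) as (e & b & He & Hb).
    exists e, b. split; [assumption|]. intros s Hs. apply Hb.
    now replace (a + s - (a + t)) with (s - t) by ring.
  - intros t k. destruct (H2 (a + t) k) as [Hr Hi].
    split; [apply is_derive_ext with (fun s => fst (u (a + 1 * s) k))
           |apply is_derive_ext with (fun s => snd (u (a + 1 * s) k))];
      try (intros s; now rewrite Rmult_1_l).
    + rewrite <- (Rmult_1_l (fst _)).
      apply (is_derive_comp_affine (fun s => fst (u s k))). now rewrite Rmult_1_l.
    + rewrite <- (Rmult_1_l (snd _)).
      apply (is_derive_comp_affine (fun s => snd (u s k))). now rewrite Rmult_1_l.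
Qed.

Lemma Cconj_CSum n f : Cconj (CSum n f) = CSum n (fun i => Cconj (f i)).
Proof.
  induction n as [|n IH]; simpl; [apply injective_projections; simpl; ring|].
  now rewrite Cplus_conj, IH.
Qed.

Lemma is_series_conj (f : nat -> C) (l : C) :
  is_series f l -> is_series (fun n => Cconj (f n)) (Cconj l).
Proof.
  intros H. apply filterlim_locally_ball_norm. intros e.
  destruct (proj1 (filterlim_locally_ball_norm _ _) H e) as [N HN].
  exists N. intros n Hn. specialize (HN n Hn).
  change (Cmod (Cminus (sum_n f n) l) < e) in HN.
  change (Cmod (Cminus (sum_n (fun n => Cconj (f n)) n) (Cconj l)) < e).
  rewrite <- Cmod_conj in HN. rewrite CSum_sum_n in *.
  unfold Cminus in *. now rewrite Cplus_conj, Copp_conj, Cconj_CSum in HN.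
Qed.

(** Conjugating the coefficients is the map from u(theta) to conj(u(-theta)), which preserves the
    Hardy space. Combined with t -> -t it turns i d into its conjugate, hence preserves the
    equation. *)
Lemma flow_reflect u d :
  flow u d -> flow (fun t k => Cconj (u (- t) k)) (fun t k => Copp (Cconj (d (- t) k))).
Proof.
  intros (H1 & H2 & H3). split; [|split].
  - intros t. destruct (H1 (- t)) as (e & b & He & Hb).
    exists e, b. split; [assumption|]. intros s Hs m.
    erewrite Sum_ext; [apply (Hb (- s)) with (m := m)|].
    + replace (- s - - t) with (- (s - t)) by ring. now rewrite Rabs_Ropp.
    + intros k _. cbv beta. now rewrite Cmod_conj.
  - intros t k. destruct (H2 (- t) k) as [Hr Hi].
    replace (- t) with (0 + -1 * t) in * by ring. split.
    + apply is_derive_ext with (fun s => fst (u (0 + -1 * s) k)).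
      { intros s. simpl. do 2 f_equal; ring. }
      replace (fst _) with (-1 * fst (d (0 + -1 * t) k)) by (simpl; ring).
      now apply (is_derive_comp_affine (fun s => fst (u s k))).
    + apply is_derive_ext with (fun s => - snd (u (0 + -1 * s) k)).
      { intros s. simpl. do 3 f_equal; ring. }
      replace (snd _) with (- (-1 * snd (d (0 + -1 * t) k))) by (simpl; ring).
      apply (is_derive_opp (fun s => snd (u (0 + -1 * s) k))).
      now apply (is_derive_comp_affine (fun s => snd (u s k))).
  - intros t k. specialize (H3 (- t) k). apply is_series_conj in H3.
    replace (Cmult Ci _) with (Cconj (Cmult Ci (d (- t) k)))
      by (apply injective_projections; simpl; ring).
    eapply is_series_ext; [|exact H3]. intros q. simpl. unfold szego_term.
    rewrite !CSum_sum_n, Cmult_conj, Cconj_CSum.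
    f_equal. apply CSum_ext; intros p _. now rewrite Cmult_conj.
Qed.

(** * Mean value inequalities and expansion in the Wiener norm *)

Lemma mean_value_le (f f' : R -> R) a b L : a <= b ->
  (forall r, a <= r <= b -> is_derive f r (f' r)) ->
  (forall r, a <= r <= b -> f' r <= L) -> f b - f a <= L * (b - a).
Proof.
  intros Hab Hd HL.
  destruct (MVT_gen f a b f') as (c & Hc & E);
    rewrite ?Rmin_left, ?Rmax_right in * by assumption.
  - intros x Hx. apply Hd. lra.
  - intros x Hx. apply continuity_pt_filterlim, (@ex_derive_continuous R_AbsRing R_NormedModule).
    exists (f' x). now apply Hd.
  - rewrite E. apply Rmult_le_compat_r; [lra|]. now apply HL.
Qed.

Lemma is_derive_Sum m (f : nat -> R -> R) (f' : nat -> R) (t : R) :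
  (forall k, is_derive (f k) t (f' k)) ->
  is_derive (fun s => Sum m (fun k => f k s)) t (Sum m f').
Proof.
  intros H. induction m as [|m IH]; simpl; [apply (@is_derive_const R_AbsRing R_NormedModule)|].
  now apply (is_derive_plus (fun s => Sum m (fun k => f k s))).
Qed.

Lemma dot_le_Cmod (c z : C) : fst c * fst z + snd c * snd z <= Cmod c * Cmod z.
Proof.
  rewrite <- (Cmod_conj c), <- Cmod_mult.
  eapply Rle_trans; [|apply re_le_Cmod].
  eapply Rle_trans; [|apply Rle_abs]. unfold Re. simpl. right; ring.
Qed.

Lemma Cmod_dot (z : C) : fst z * fst z + snd z * snd z = Cmod z * Cmod z.
Proof. pose proof (Cmod2_alt z) as H. unfold Re, Im in H. simpl in H. lra. Qed.

(* Test against the unimodular multipliers [c k] aligned with the increments. *)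
Lemma mean_value_l1 (z z' : R -> nat -> C) a b L m : a <= b ->
  (forall r k, a <= r <= b -> Cderive (fun s => z s k) r (z' r k)) ->
  (forall r, a <= r <= b -> Sum m (fun k => Cmod (z' r k)) <= L) ->
  Sum m (fun k => Cmod (Cminus (z b k) (z a k))) <= L * (b - a).
Proof.
  intros Hab Hd HL.
  set (w := fun k => Cminus (z b k) (z a k)).
  assert (Hc : forall k, exists c : C, Cmod c <= 1 /\
            fst c * fst (w k) + snd c * snd (w k) = Cmod (w k)).
  { intros k. generalize (w k) as x. clear. intros x.
    destruct (Req_dec (Cmod x) 0) as [E|E].
    - exists (RtoC 0). rewrite Cmod_0, E. simpl. lra.
    - exists (Cmult (RtoC (/ Cmod x)) x). rewrite Cmod_mult, Cmod_R.
      pose proof (Cmod_ge_0 x). split.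
      + rewrite Rabs_pos_eq; [right; field; assumption|].
        left; apply Rinv_0_lt_compat; lra.
      + simpl. pose proof (Cmod_dot x) as D.
        transitivity (/ Cmod x * (fst x * fst x + snd x * snd x)); [ring|].
        rewrite D. field; assumption. }
  set (c := fun k => proj1_sig (constructive_indefinite_description _ (Hc k))).
  assert (Hc1 : forall k, Cmod (c k) <= 1 /\ fst (c k) * fst (w k) + snd (c k) * snd (w k) = Cmod (w k))
    by (intros k; exact (proj2_sig (constructive_indefinite_description _ (Hc k)))).
  clearbody c.
  set (f := fun s => Sum m (fun k => fst (c k) * fst (z s k) + snd (c k) * snd (z s k))).
  replace (Sum m _) with (f b - f a).
  - apply mean_value_le with
      (fun s => Sum m (fun k => fst (c k) * fst (z' s k) + snd (c k) * snd (z' s k))).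
    + assumption.
    + intros r Hr. apply (is_derive_Sum m
        (fun k s => fst (c k) * fst (z s k) + snd (c k) * snd (z s k))).
      intros k. destruct (Hd r k Hr) as [H1 H2].
      apply (is_derive_plus (fun s => fst (c k) * fst (z s k)));
        apply is_derive_scal; assumption.
    + intros r Hr. eapply Rle_trans; [|apply (HL r Hr)].
      apply Sum_le; intros k _. eapply Rle_trans; [apply dot_le_Cmod|].
      rewrite <- (Rmult_1_l (Cmod (z' r k))) at 2.
      apply Rmult_le_compat_r; [apply Cmod_ge_0|apply Hc1].
  - unfold f. rewrite <- Sum_minus. apply Sum_ext; intros k _.
    change (Cmod (Cminus (z b k) (z a k))) with (Cmod (w k)).
    rewrite <- (proj2 (Hc1 k)). unfold w. simpl. ring.
Qed.

Lemma Cmod_cubic a p q r : Cmod (cubic a p q r) = Cmod (a p) * (Cmod (a q) * Cmod (a r)).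
Proof. unfold cubic. rewrite !Cmod_mult, Cmod_conj. ring. Qed.

Lemma cubic_diff_le u v p q r :
  Cmod (Cminus (cubic u p q r) (cubic v p q r)) <=
  Cmod (Cminus (u p) (v p)) * (Cmod (u q) * Cmod (u r)) +
  Cmod (v p) * (Cmod (Cminus (u q) (v q)) * Cmod (u r)) +
  Cmod (v p) * (Cmod (v q) * Cmod (Cminus (u r) (v r))).
Proof.
  replace (Cminus (cubic u p q r) (cubic v p q r)) with
    (Cplus (Cplus (Cmult (Cminus (u p) (v p)) (Cmult (Cconj (u q)) (u r)))
                  (Cmult (v p) (Cmult (Cconj (Cminus (u q) (v q))) (u r))))
           (Cmult (v p) (Cmult (Cconj (v q)) (Cminus (u r) (v r))))).
  - eapply Rle_trans; [apply Cmod_triangle|]. apply Rplus_le_compat.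
    + eapply Rle_trans; [apply Cmod_triangle|].
      now rewrite !Cmod_mult, !Cmod_conj; right.
    + rewrite !Cmod_mult, !Cmod_conj; lra.
  - unfold cubic, Cminus. rewrite Cplus_conj, Copp_conj. ring.
Qed.

Lemma Cmod_Ci : Cmod Ci = 1.
Proof.
  unfold Cmod, Ci. simpl. replace (0 * (0 * 1) + 1 * (1 * 1)) with 1 by ring. apply sqrt_1.
Qed.

Lemma szego_zero k : is_series (szego_term (fun _ => RtoC 0) k) (RtoC 0).
Proof.
  apply filterlim_ext with (fun _ : nat => RtoC 0); [|apply filterlim_const].
  intros n. rewrite CSum_sum_n, (CSum_ext _ _ (fun _ => RtoC 0)), CSum_zero; [reflexivity|].
  intros i _. unfold szego_term.
  replace (Cconj (RtoC 0)) with (RtoC 0) by (apply injective_projections; simpl; ring).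
  apply Cmult_0_l.
Qed.

Section Flow.
Variables u d : R -> nat -> C.
Hypothesis Hflow : flow u d.

Lemma flow_rate_le t c B m :
  (forall k, 0 <= c k) ->
  (forall J, Q4 J (fun k p q r =>
     c k * (Cmod (u t p) * (Cmod (u t q) * Cmod (u t r)))) <= B) ->
  Sum m (fun k => c k * Cmod (d t k)) <= B.
Proof.
  intros Hc HB. destruct Hflow as (_ & _ & H3).
  erewrite Sum_ext.
  - apply (cubic_compare (u t) (fun _ => RtoC 0) (fun k => Cmult Ci (d t k)) (fun _ => RtoC 0) c
      (fun p q r => Cmod (u t p) * (Cmod (u t q) * Cmod (u t r))) B m Hc).
    + intros k _. apply H3.
    + intros k _. apply szego_zero.
    + intros p q r. right. rewrite <- Cmod_cubic. f_equal. unfold cubic. ring.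
    + exact HB.
  - intros k _. cbv beta. f_equal.
    replace (Cminus _ _) with (Cmult Ci (d t k)) by ring.
    rewrite Cmod_mult, Cmod_Ci. ring.
Qed.

Lemma flow_rate_diff_le t s M D m :
  (forall n, Sum n (fun k => Cmod (u t k)) <= M) ->
  (forall n, Sum n (fun k => Cmod (u s k)) <= M) ->
  (forall n, Sum n (fun k => Cmod (Cminus (u t k) (u s k))) <= D) ->
  Sum m (fun k => Cmod (Cminus (d t k) (d s k))) <= 3 * M ^ 2 * D.
Proof.
  intros Ht Hs HD. destruct Hflow as (_ & _ & H3).
  erewrite Sum_ext.
  - apply (cubic_compare (u t) (u s) (fun k => Cmult Ci (d t k)) (fun k => Cmult Ci (d s k))
      (fun _ => 1) _ (3 * M ^ 2 * D) m (fun _ => Rle_0_1)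
      (fun k _ => H3 t k) (fun k _ => H3 s k) (cubic_diff_le (u t) (u s))).
    intros J. rewrite Q4_scal, !Q4_plus, Rmult_1_l.
    replace (3 * M ^ 2 * D) with (D * (M * M) + M * (D * M) + M * (M * D)) by ring.
    repeat apply Rplus_le_compat.
    + apply (Q4_omit_k J (fun p => Cmod (Cminus (u t p) (u s p)))
        (fun q => Cmod (u t q)) (fun r => Cmod (u t r))); intros; auto using Cmod_ge_0.
    + apply (Q4_omit_k J (fun p => Cmod (u s p))
        (fun q => Cmod (Cminus (u t q) (u s q))) (fun r => Cmod (u t r)));
        intros; auto using Cmod_ge_0.
    + apply (Q4_omit_k J (fun p => Cmod (u s p))
        (fun q => Cmod (u s q)) (fun r => Cmod (Cminus (u t r) (u s r))));
        intros; auto using Cmod_ge_0.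
  - intros k _. cbv beta.
    replace (Cminus (Cmult Ci (d t k)) (Cmult Ci (d s k)))
      with (Cmult Ci (Cminus (d t k) (d s k))) by ring.
    rewrite Cmod_mult, Cmod_Ci. ring.
Qed.

Variables T M : R.
Hypothesis HM : forall t, 0 <= t <= T -> forall n, Sum n (fun k => Cmod (u t k)) <= M.

Lemma flow_rate_l1 t m : 0 <= t <= T -> Sum m (fun k => Cmod (d t k)) <= M ^ 3.
Proof.
  intros Ht. erewrite Sum_ext.
  - apply (flow_rate_le t (fun _ => 1) (M ^ 3) m (fun _ => Rle_0_1)). intros J.
    rewrite Q4_scal, Rmult_1_l. replace (M ^ 3) with (M * (M * M)) by ring.
    apply (Q4_omit_k J (fun p => Cmod (u t p)) (fun q => Cmod (u t q))
      (fun r => Cmod (u t r))); intros; auto using Cmod_ge_0.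
  - intros k _. cbv beta. ring.
Qed.

Lemma flow_lipschitz t s m : 0 <= t -> t <= s -> s <= T ->
  Sum m (fun k => Cmod (Cminus (u s k) (u t k))) <= M ^ 3 * (s - t).
Proof.
  intros H0 Hts HT. destruct Hflow as (_ & H2 & _).
  apply (mean_value_l1 u d); [assumption|intros; apply H2|].
  intros r Hr. apply flow_rate_l1. lra.
Qed.

(** The function u(s) - (s - t) d(t) has derivative d(s) - d(t). The cubic term is Lipschitz in l^1
    with constant 3 M^2, and u moves at speed at most M^3, whence 3 M^5. This uniform expansion is
    the substitute for differentiating norms. *)
Lemma flow_taylor t h m : 0 <= t -> 0 <= h -> t + h <= T ->
  Sum m (fun k => Cmod (Cminus (u (t + h) k) (Cplus (u t k) (Cmult (RtoC h) (d t k)))))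
  <= 3 * M ^ 5 * h ^ 2.
Proof.
  intros H0 Hh HT. destruct Hflow as (_ & H2 & _).
  assert (HM0 : 0 <= M).
  { apply Rle_trans with (2 := HM t ltac:(lra) O). simpl; lra. }
  replace (3 * M ^ 5 * h ^ 2) with (3 * M ^ 2 * (M ^ 3 * h) * (t + h - t)) by ring.
  erewrite Sum_ext; [apply (mean_value_l1
    (fun s k => Cminus (u s k) (Cmult (RtoC (s - t)) (d t k)))
    (fun s k => Cminus (d s k) (d t k)) t (t + h))|].
  - lra.
  - intros r k Hr. destruct (H2 r k) as [Hre Him]. split; simpl.
    + apply is_derive_ext with (fun s => fst (u s k) + - ((s - t) * fst (d t k)));
        [intros s; simpl; ring|].
      apply (is_derive_plus (fun s => fst (u s k)) _ r _ _ Hre).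
      apply (is_derive_opp (fun s => (s - t) * fst (d t k))).
      auto_derive; [trivial|ring].
    + apply is_derive_ext with (fun s => snd (u s k) + - ((s - t) * snd (d t k)));
        [intros s; simpl; ring|].
      apply (is_derive_plus (fun s => snd (u s k)) _ r _ _ Him).
      apply (is_derive_opp (fun s => (s - t) * snd (d t k))).
      auto_derive; [trivial|ring].
  - intros r Hr. apply flow_rate_diff_le; [apply HM; lra|apply HM; lra|].
    intros n. eapply Rle_trans; [apply flow_lipschitz; lra|].
    apply Rmult_le_compat_l; [now apply pow_le|lra].
  - intros k _. cbv beta. f_equal.
    replace (t + h - t) with h by ring. replace (t - t) with 0 by ring. ring.
Qed.
End Flow.

(** * Propagation of the Gevrey norm under a Wiener bound *)

(* Accumulating one-step errors of size [O(h^2)] over [n] steps of size [T/n]. *)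
Lemma euler_bound (P : R -> R -> Prop) T e0 rho B :
  0 <= T -> 0 <= B -> 0 <= rho ->
  (forall t h e, 0 <= t -> 0 <= h -> t + h <= T -> e <= e0 + rho * T + 1 ->
     P t e -> P (t + h) (e + rho * h + B * h ^ 2)) ->
  P 0 e0 -> forall eps, 0 < eps -> exists e, e <= e0 + rho * T + eps /\ P T e.
Proof.
  intros HT HB Hrho Hstep H0 eps Heps.
  (* The total accumulated error is kept below 1 as well as below [eps], so that every intermediate
     [e] stays in the range where [Hstep] applies. *)
  set (a := Rmin 1 eps).
  assert (Ha : 0 < a) by (apply Rmin_glb_lt; lra).
  destruct (INR_unbounded (Rmax 1 (B * T ^ 2 / a))) as [n Hn].
  assert (Hn1 : 1 < INR n) by (eapply Rle_lt_trans; [apply Rmax_l|exact Hn]).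
  assert (Hn2 : B * T ^ 2 / a < INR n) by (eapply Rle_lt_trans; [apply Rmax_r|exact Hn]).
  set (h := T / INR n).
  assert (Hh : 0 <= h) by (apply Rmult_le_pos; [|left; apply Rinv_0_lt_compat]; lra).
  assert (HnT : INR n * h = T) by (unfold h; field; lra).
  assert (Herr : INR n * (B * h ^ 2) <= a).
  { apply Rmult_le_reg_r with (INR n); [lra|].
    replace (INR n * (B * h ^ 2) * INR n) with (B * T ^ 2) by (rewrite <- HnT; ring).
    apply (Rmult_lt_compat_r a) in Hn2; [|assumption].
    unfold Rdiv in Hn2. rewrite Rmult_assoc, Rinv_l in Hn2 by lra. lra. }
  assert (a <= 1) by apply Rmin_l. assert (a <= eps) by apply Rmin_r.
  assert (Bh : 0 <= B * h ^ 2) by (apply Rmult_le_pos; [assumption|apply pow2_ge_0]).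
  assert (Hj : forall j, (j <= n)%nat ->
            P (INR j * h) (e0 + rho * (INR j * h) + INR j * (B * h ^ 2))).
  { induction j as [|j IH]; intros Hjn.
    - simpl. replace (0 * h) with 0 by ring.
      replace (e0 + _ + _) with e0 by ring. assumption.
    - apply le_INR in Hjn as Hjr. rewrite S_INR in *.
      assert (Hjh : (INR j + 1) * h <= T)
        by (rewrite <- HnT; apply Rmult_le_compat_r; assumption).
      pose proof (pos_INR j).
      replace ((INR j + 1) * h) with (INR j * h + h) by ring.
      replace (e0 + _ + _) with
        (e0 + rho * (INR j * h) + INR j * (B * h ^ 2) + rho * h + B * h ^ 2) by ring.
      apply Hstep; [nra|assumption|lra| |apply IH; lia].
      assert (rho * (INR j * h) <= rho * T) by (apply Rmult_le_compat_l; lra).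
      assert (INR j * (B * h ^ 2) <= INR n * (B * h ^ 2))
        by (apply Rmult_le_compat_r; lra).
      lra. }
  specialize (Hj n (le_n n)). rewrite HnT in Hj. eexists; split; [|exact Hj]. lra.
Qed.

Lemma exp_minus_1_le y : exp y - 1 <= y * exp y.
Proof.
  pose proof (exp_ineq1_le (- y)) as H. rewrite exp_Ropp in H.
  pose proof (exp_pos y) as Hp.
  apply (Rmult_le_compat_r (exp y)) in H; [|lra].
  rewrite Rinv_l in H by lra. lra.
Qed.

Lemma exp_opp_ge y : 1 - y <= exp (- y).
Proof. pose proof (exp_ineq1_le (- y)). lra. Qed.

Lemma exp_opp_le y : 0 <= y -> exp (- y) <= 1 - y + y ^ 2.
Proof.
  intros Hy. rewrite exp_Ropp. pose proof (exp_ineq1_le y).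
  apply Rle_trans with (/ (1 + y)); [apply Rinv_le_contravar; lra|].
  apply Rmult_le_reg_r with (1 + y); [lra|]. rewrite Rinv_l by lra.
  assert (0 <= y ^ 3) by (apply pow_le; assumption). simpl in *. lra.
Qed.

Lemma exp_ge_1 y : 0 <= y -> 1 <= exp y.
Proof. pose proof (exp_ineq1_le y). lra. Qed.

Lemma exp_le y z : y <= z -> exp y <= exp z.
Proof. intros [H| ->]; [left; now apply exp_increasing|lra]. Qed.

(** First-order expansion of the Gevrey weight when the radius shrinks from tau to tau exp(-l h).
    The linear term is the dissipation; the quadratic remainder is uniform in the frequency [mu]
    only because of the cap [N]. *)
Lemma weight_step mu tau s N l h :
  0 <= mu <= N -> 0 <= tau <= s -> 0 <= l -> 0 <= h ->
  exp (tau * exp (- (l * h)) * mu) <=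
  exp (tau * mu) * (1 - mu * tau * l * h) +
  exp (s * N) * ((N * s + N ^ 2 * s ^ 2) * l ^ 2) * h ^ 2.
Proof.
  intros Hmu Htau Hl Hh.
  assert (Hlh : 0 <= l * h) by (apply Rmult_le_pos; assumption).
  set (y := tau * (1 - exp (- (l * h))) * mu).
  replace (tau * exp (- (l * h)) * mu) with (tau * mu + - y) by (unfold y; ring).
  rewrite exp_plus.
  pose proof (exp_opp_ge (l * h)). pose proof (exp_opp_le (l * h) Hlh).
  assert (E1 : exp (- (l * h)) <= 1) by (rewrite <- exp_0; apply exp_le; lra).
  assert (Hmt : 0 <= tau * mu) by (apply Rmult_le_pos; lra).
  assert (Hy : 0 <= y <= tau * mu * (l * h)).
  { unfold y. replace (tau * (1 - exp (- (l * h))) * mu)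
      with (tau * mu * (1 - exp (- (l * h)))) by ring. split.
    - apply Rmult_le_pos; lra.
    - apply Rmult_le_compat_l; lra. }
  assert (Hy2 : tau * mu * (l * h - (l * h) ^ 2) <= y).
  { unfold y. replace (tau * (1 - exp (- (l * h))) * mu)
      with (tau * mu * (1 - exp (- (l * h)))) by ring.
    apply Rmult_le_compat_l; lra. }
  assert (HtN : tau * mu <= s * N) by (apply Rmult_le_compat; lra).
  assert (HE : exp (- y) <= 1 - mu * tau * l * h + (N * s + N ^ 2 * s ^ 2) * l ^ 2 * h ^ 2).
  { eapply Rle_trans; [apply exp_opp_le; lra|].
    assert (y ^ 2 <= (s * N) ^ 2 * (l * h) ^ 2).
    { rewrite <- Rpow_mult_distr. apply pow_incr. split; [lra|].
      eapply Rle_trans; [apply Hy|]. apply Rmult_le_compat_r; assumption. }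
    assert (tau * mu * (l * h) ^ 2 <= s * N * (l * h) ^ 2)
      by (apply Rmult_le_compat_r; [apply pow2_ge_0|assumption]).
    lra. }
  pose proof (exp_pos (tau * mu)).
  eapply Rle_trans; [apply Rmult_le_compat_l; [lra|exact HE]|].
  rewrite Rmult_plus_distr_l. apply Rplus_le_compat_l.
  rewrite (Rmult_assoc (exp (s * N))).
  apply Rmult_le_compat_r; [|now apply exp_le].
  apply Rmult_le_pos; [|apply pow2_ge_0]. apply Rmult_le_pos; [|apply pow2_ge_0].
  apply Rplus_le_le_0_compat; [apply Rmult_le_pos; lra|].
  apply Rmult_le_pos; apply pow2_ge_0.
Qed.

(** [D] stands for the infinite sum. The last clause gives partial sums close to [D] beyond any
    prescribed length, as required when the sum enters an estimate with both signs. *)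
Lemma bounded_partial_sums_sup f B :
  (forall i, 0 <= f i) -> (forall m, Sum m f <= B) ->
  exists D, 0 <= D /\ (forall m, Sum m f <= D) /\
    forall eps, 0 < eps -> forall m, exists n, (m <= n)%nat /\ D - eps < Sum n f.
Proof.
  intros Hf HB.
  destruct (completeness (fun y => exists m, y = Sum m f)) as [D [HD1 HD2]].
  - exists B. intros y [m ->]. apply HB.
  - exists 0, O. reflexivity.
  - assert (HD : forall m, Sum m f <= D) by (intros m; apply HD1; now exists m).
    exists D. split; [apply (HD O)|]. split; [exact HD|].
    intros eps Heps m. apply NNPP. intros Hn.
    assert (D <= D - eps); [|lra].
    apply HD2. intros y [j ->]. apply Rnot_lt_le. intros Hj. apply Hn.
    exists (max m j). split; [lia|].
    eapply Rlt_le_trans; [exact Hj|]. apply Sum_le_size; [lia|assumption].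
Qed.

(** The cap makes weighted sums finite under a mere Wiener bound, and min(k, K) is still subadditive
    in k. *)
Definition wt (K : nat) (tau : R) (k : nat) : R := exp (tau * INR (min k K)).

Lemma wt_ge_1 K tau k : 0 <= tau -> 1 <= wt K tau k.
Proof. intros H. apply exp_ge_1. apply Rmult_le_pos; [assumption|apply pos_INR]. Qed.

(** On the resonance k = p - q + r <= p + r: the conjugated mode lowers the frequency, so the weight
    of k is shared by p and r alone. *)
Lemma wt_resonance K tau k p q r : 0 <= tau -> (k + q = p + r)%nat ->
  wt K tau k - 1 <=
  tau * (INR (min p K) + INR (min r K)) * (wt K tau p * wt K tau r).
Proof.
  intros Ht E. unfold wt. rewrite <- exp_plus, <- Rmult_plus_distr_l.
  assert (H : INR (min k K) <= INR (min p K) + INR (min r K))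
    by (rewrite <- plus_INR; apply le_INR; lia).
  apply Rle_trans with (exp (tau * (INR (min p K) + INR (min r K))) - 1).
  - apply Rplus_le_compat_r, exp_le. now apply Rmult_le_compat_l.
  - apply exp_minus_1_le.
Qed.

Section Gevrey.
Variables (u d : R -> nat -> C) (T M : R).
Hypothesis Hflow : flow u d.
Hypothesis HM : forall t, 0 <= t <= T -> forall n, Sum n (fun k => Cmod (u t k)) <= M.

(** In each resonant product one mode carries the derivative and sums to [D], the conjugated mode is
    unweighted and sums to [M], the remaining one carries the bare weight and sums to at most M + e.
    The factor 2 counts whether p or r takes the derivative. *)
Lemma gevrey_rate K tau t e D m : 0 <= t <= T -> 0 <= tau ->
  (forall n, Sum n (fun k => (wt K tau k - 1) * Cmod (u t k)) <= e) ->
  (forall n, Sum n (fun k => INR (min k K) * wt K tau k * Cmod (u t k)) <= D) ->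
  Sum m (fun k => (wt K tau k - 1) * Cmod (d t k)) <= tau * (2 * (D * (M * (M + e)))).
Proof.
  intros Ht Htau He HD.
  assert (Hw : forall n, Sum n (fun k => wt K tau k * Cmod (u t k)) <= M + e).
  { intros n. rewrite (Sum_ext _ _
      (fun k => Cmod (u t k) + (wt K tau k - 1) * Cmod (u t k))) by (intros; ring).
    rewrite Sum_plus. specialize (He n). specialize (HM t Ht n). lra. }
  assert (W1 : forall k, 1 <= wt K tau k) by (intros; now apply wt_ge_1).
  assert (W0 : forall k, 0 <= wt K tau k * Cmod (u t k)).
  { intros k. specialize (W1 k). apply Rmult_le_pos; [lra|apply Cmod_ge_0]. }
  assert (D0 : forall k, 0 <= INR (min k K) * wt K tau k * Cmod (u t k)).
  { intros k. rewrite Rmult_assoc. apply Rmult_le_pos; [apply pos_INR|apply W0]. }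
  apply (flow_rate_le u d Hflow t (fun k => wt K tau k - 1)).
  - intros k. specialize (W1 k). lra.
  - intros J.
    apply Rle_trans with (Q4 J (fun k p q r =>
      tau * (INR (min p K) * wt K tau p * Cmod (u t p) * (Cmod (u t q) * (wt K tau r * Cmod (u t r))) +
             wt K tau p * Cmod (u t p) * (Cmod (u t q) * (INR (min r K) * wt K tau r * Cmod (u t r)))))).
    + apply Q4_le. intros k p q r E.
      eapply Rle_trans; [apply Rmult_le_compat_r; [|apply (wt_resonance K tau k p q r Htau E)]|].
      * repeat apply Rmult_le_pos; apply Cmod_ge_0.
      * right; ring.
    + rewrite Q4_scal, Q4_plus. apply Rmult_le_compat_l; [assumption|].
      replace (2 * (D * (M * (M + e)))) with (D * (M * (M + e)) + (M + e) * (M * D)) by ring.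
      apply Rplus_le_compat.
      * apply (Q4_omit_k J (fun p => INR (min p K) * wt K tau p * Cmod (u t p))
          (fun q => Cmod (u t q)) (fun r => wt K tau r * Cmod (u t r)));
          auto using Cmod_ge_0.
      * apply (Q4_omit_k J (fun p => wt K tau p * Cmod (u t p))
          (fun q => Cmod (u t q)) (fun r => INR (min r K) * wt K tau r * Cmod (u t r)));
          auto using Cmod_ge_0.
Qed.

(** Shrinking the radius gains h l tau D, which absorbs the growth 2 h tau D M (M + e). The h^2
    constant is exponential in [K], which is harmless since [K] stays fixed while the step is
    refined. *)
Lemma gevrey_step K s l t h e m :
  0 <= s -> 0 <= l -> 2 * (M * (M + e)) <= l ->
  0 <= t -> 0 <= h -> t + h <= T ->
  (forall n, Sum n (fun k => (wt K (s * exp (- (l * t))) k - 1) * Cmod (u t k)) <= e) ->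
  Sum m (fun k => (wt K (s * exp (- (l * (t + h)))) k - 1) * Cmod (u (t + h) k)) <=
  e + exp (s * INR K) * ((INR K * s + INR K ^ 2 * s ^ 2) * l ^ 2 * M + 3 * M ^ 5) * h ^ 2.
Proof.
  intros Hs Hl HlM Ht Hh HT He.
  set (tau := s * exp (- (l * t))) in *.
  assert (Htau : 0 <= tau <= s).
  { unfold tau. pose proof (exp_pos (- (l * t))).
    assert (exp (- (l * t)) <= 1).
    { rewrite <- exp_0; apply exp_le.
      assert (0 <= l * t) by (apply Rmult_le_pos; lra). lra. }
    split; [apply Rmult_le_pos; lra|]. rewrite <- (Rmult_1_r s) at 2.
    apply Rmult_le_compat_l; lra. }
  replace (s * exp (- (l * (t + h)))) with (tau * exp (- (l * h)))
    by (unfold tau; rewrite Rmult_assoc, <- exp_plus; do 2 f_equal; ring).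
  set (tau' := tau * exp (- (l * h))).
  assert (Htau' : 0 <= tau' <= tau).
  { unfold tau'. pose proof (exp_pos (- (l * h))).
    assert (exp (- (l * h)) <= 1).
    { rewrite <- exp_0; apply exp_le.
      assert (0 <= l * h) by (apply Rmult_le_pos; lra). lra. }
    split; [apply Rmult_le_pos; lra|]. rewrite <- (Rmult_1_r tau) at 2.
    apply Rmult_le_compat_l; lra. }
  assert (Hmin : forall k, 0 <= INR (min k K) <= INR K)
    by (intros; split; [apply pos_INR|apply le_INR; lia]).
  assert (HwK : forall k, wt K tau k <= exp (s * INR K)).
  { intros k. apply exp_le, Rmult_le_compat; try lra; apply Hmin. }
  assert (Hw' : forall k, wt K tau' k <= wt K tau k)
    by (intros k; apply exp_le, Rmult_le_compat_r; [apply Hmin|lra]).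
  assert (W1 : forall k, 1 <= wt K tau k) by (intros; apply wt_ge_1; lra).
  assert (W1' : forall k, 1 <= wt K tau' k) by (intros; apply wt_ge_1; lra).
  set (g := fun k => INR (min k K) * wt K tau k * Cmod (u t k)).
  assert (Hg : forall k, 0 <= g k).
  { intros k. specialize (W1 k). apply Rmult_le_pos; [|apply Cmod_ge_0].
    apply Rmult_le_pos; [apply Hmin|lra]. }
  destruct (bounded_partial_sums_sup g (INR K * exp (s * INR K) * M) Hg) as (D & D0 & HD & HDlim).
  { intros n. eapply Rle_trans; [|apply Rmult_le_compat_l; [|apply (HM t ltac:(lra) n)]].
    - rewrite <- Sum_scal. apply Sum_le; intros k _.
      apply Rmult_le_compat_r; [apply Cmod_ge_0|]. specialize (W1 k).
      apply Rmult_le_compat; try apply Hmin; [lra|apply HwK].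
    - apply Rmult_le_pos; [apply pos_INR|left; apply exp_pos]. }
  set (A := (INR K * s + INR K ^ 2 * s ^ 2) * l ^ 2).
  assert (HA : 0 <= A).
  { unfold A. apply Rmult_le_pos; [|apply pow2_ge_0].
    apply Rplus_le_le_0_compat; [apply Rmult_le_pos; [apply pos_INR|lra]|].
    apply Rmult_le_pos; apply pow2_ge_0. }
  set (rem := fun k => Cmod (Cminus (u (t + h) k) (Cplus (u t k) (Cmult (RtoC h) (d t k))))).
  assert (Hpt : forall k, (wt K tau' k - 1) * Cmod (u (t + h) k) <=
    (wt K tau k - 1) * Cmod (u t k) + (- (h * (l * tau))) * g k
    + (exp (s * INR K) * A * h ^ 2) * Cmod (u t k)
    + h * ((wt K tau k - 1) * Cmod (d t k)) + exp (s * INR K) * rem k).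
  { intros k.
    assert (Hu : Cmod (u (t + h) k) <= Cmod (u t k) + h * Cmod (d t k) + rem k).
    { unfold rem. replace (u (t + h) k) with
        (Cplus (Cplus (u t k) (Cmult (RtoC h) (d t k)))
          (Cminus (u (t + h) k) (Cplus (u t k) (Cmult (RtoC h) (d t k))))) at 1 by ring.
      eapply Rle_trans; [apply Cmod_triangle|]. apply Rplus_le_compat_r.
      eapply Rle_trans; [apply Cmod_triangle|].
      rewrite Cmod_mult, Cmod_R, Rabs_pos_eq by assumption. lra. }
    pose proof (weight_step (INR (min k K)) tau s (INR K) l h (Hmin k) Htau Hl Hh) as HW.
    fold tau' (wt K tau' k) (wt K tau k) A in HW.
    specialize (Hw' k). specialize (W1 k). specialize (W1' k). specialize (HwK k).
    pose proof (Cmod_ge_0 (u t k)). pose proof (Cmod_ge_0 (d t k)).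
    assert (0 <= rem k) by apply Cmod_ge_0.
    eapply Rle_trans; [apply Rmult_le_compat_l; [lra|exact Hu]|].
    assert (X1 : (wt K tau' k - 1) * Cmod (u t k) <=
      (wt K tau k * (1 - INR (min k K) * tau * l * h) + exp (s * INR K) * A * h ^ 2 - 1) * Cmod (u t k))
      by (apply Rmult_le_compat_r; lra).
    assert (X2 : (wt K tau' k - 1) * (h * Cmod (d t k)) <= (wt K tau k - 1) * (h * Cmod (d t k)))
      by (apply Rmult_le_compat_r; [apply Rmult_le_pos|]; lra).
    assert (X3 : (wt K tau' k - 1) * rem k <= exp (s * INR K) * rem k)
      by (apply Rmult_le_compat_r; lra).
    unfold g. lra. }
  apply le_epsilon. intros eps Heps.
  set (z := h * (l * tau)).
  assert (Hz : 0 <= z) by (apply Rmult_le_pos; [|apply Rmult_le_pos]; lra).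
  (* The gain is summed only up to [n], while the growth is bounded through the full [D]. Taking [n]
     large makes this mismatch cost at most [eps]; z + 1 in the denominator covers z = 0. *)
  destruct (HDlim (eps / (z + 1)) ltac:(apply Rdiv_lt_0_compat; lra) m) as (n & Hmn & Hn).
  apply Rle_trans with (Sum n (fun k => (wt K tau' k - 1) * Cmod (u (t + h) k))).
  { apply Sum_le_size; [assumption|]. intros k. specialize (W1' k).
    apply Rmult_le_pos; [lra|apply Cmod_ge_0]. }
  eapply Rle_trans; [apply Sum_le; intros k _; apply Hpt|].
  rewrite !Sum_plus, !Sum_scal. fold z.
  pose proof (gevrey_rate K tau t e D n ltac:(lra) ltac:(lra) He HD) as HR.
  pose proof (flow_taylor u d Hflow T M HM t h n Ht Hh HT) as HTa. fold rem in HTa.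
  pose proof (exp_pos (s * INR K)) as HE.
  specialize (He n). specialize (HM t ltac:(lra) n).
  assert (Y1 : exp (s * INR K) * A * h ^ 2 * Sum n (fun k => Cmod (u t k)) <=
               exp (s * INR K) * A * h ^ 2 * M).
  { apply Rmult_le_compat_l; [|assumption].
    apply Rmult_le_pos; [apply Rmult_le_pos; lra|apply pow2_ge_0]. }
  assert (Y2 : exp (s * INR K) * Sum n rem <= exp (s * INR K) * (3 * M ^ 5 * h ^ 2))
    by (apply Rmult_le_compat_l; lra).
  assert (Y3 : h * Sum n (fun k => (wt K tau k - 1) * Cmod (d t k)) <= z * D).
  { eapply Rle_trans; [apply Rmult_le_compat_l; [lra|exact HR]|]. unfold z.
    replace (h * (tau * (2 * (D * (M * (M + e)))))) with (h * tau * D * (2 * (M * (M + e)))) by ring.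
    replace (h * (l * tau) * D) with (h * tau * D * l) by ring.
    apply Rmult_le_compat_l; [|assumption].
    apply Rmult_le_pos; [apply Rmult_le_pos|]; lra. }
  assert (Y4 : z * (D - eps / (z + 1)) <= z * Sum n g) by (apply Rmult_le_compat_l; lra).
  assert (Y5 : z * (eps / (z + 1)) <= eps).
  { replace eps with ((z + 1) * (eps / (z + 1))) at 2 by (field; lra).
    apply Rmult_le_compat_r; [left; apply Rdiv_lt_0_compat|]; lra. }
  lra.
Qed.

Lemma gevrey_propagation s l e0 t m :
  0 <= s -> 0 <= l -> 2 * (M * (M + (e0 + 1))) <= l -> 0 <= t <= T ->
  (forall n, Sum n (fun k => (exp (s * INR k) - 1) * Cmod (u 0 k)) <= e0) ->
  Sum m (fun k => (exp (s * exp (- (l * t)) * INR k) - 1) * Cmod (u t k)) <= e0.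
Proof.
  intros Hs Hl HlM Ht He0.
  assert (HM0 : 0 <= M) by apply (HM t Ht O).
  apply le_epsilon. intros eps Heps.
  (* The cap is placed at [m], so the modes below [m] carry the true Gevrey weight. The 1 in e0 + 1
     is the slack that [euler_bound] leaves to intermediate values. *)
  set (P := fun r e => forall n,
    Sum n (fun k => (wt m (s * exp (- (l * r))) k - 1) * Cmod (u r k)) <= e).
  destruct (euler_bound P t e0 0
    (exp (s * INR m) * ((INR m * s + INR m ^ 2 * s ^ 2) * l ^ 2 * M + 3 * M ^ 5)))
    with (eps := eps) as (e & He & HP); try lra.
  - apply Rmult_le_pos; [left; apply exp_pos|].
    apply Rplus_le_le_0_compat.
    + apply Rmult_le_pos; [apply Rmult_le_pos; [|apply pow2_ge_0]|assumption].
      apply Rplus_le_le_0_compat; [apply Rmult_le_pos; [apply pos_INR|lra]|].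
      apply Rmult_le_pos; apply pow2_ge_0.
    + apply Rmult_le_pos; [lra|now apply pow_le].
  - intros r h e Hr Hh Hrh He HP n. replace (e + 0 * h) with e by ring.
    apply gevrey_step; try assumption; try lra.
    eapply Rle_trans; [|exact HlM].
    apply Rmult_le_compat_l; [lra|]. apply Rmult_le_compat_l; lra.
  - intros n. eapply Rle_trans; [|apply (He0 n)].
    apply Sum_le; intros k _. apply Rmult_le_compat_r; [apply Cmod_ge_0|].
    apply Rplus_le_compat_r, exp_le. rewrite Rmult_0_r, Ropp_0, exp_0, Rmult_1_r.
    apply Rmult_le_compat_l; [assumption|]. apply le_INR. lia.
  - specialize (HP m). rewrite (Sum_ext _ _
      (fun k => (wt m (s * exp (- (l * t))) k - 1) * Cmod (u t k))); [lra|].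
    intros k Hk. unfold wt. now rewrite Nat.min_l by lia.
Qed.
End Gevrey.

(** * Short-time regularity of H^{1/2} solutions *)

(** The nonlinearity couples all modes, so the derivative of one partial sum is bounded only through
    the whole family. With S the supremum of f m t exp(-2at), integrating the rate a S exp(2at) + c
    gives S <= Y0 + c T + S/2; the doubled exponent is what produces the absorbable half. [B] makes
    S finite and leaves no trace in the bound. *)
Lemma gronwall_family (f f' : nat -> R -> R) T a c Y0 B :
  0 <= T -> 0 <= a -> 0 <= c ->
  (forall m t, 0 <= t <= T -> is_derive (f m) t (f' m t)) ->
  (forall m t, 0 <= t <= T -> 0 <= f m t <= B) ->
  (forall t y, 0 <= t <= T -> (forall m, f m t <= y) -> forall m, f' m t <= a * y + c) ->
  (forall m, f m 0 <= Y0) ->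
  forall m t, 0 <= t <= T -> f m t <= 2 * (Y0 + c * T) * exp (2 * a * t).
Proof.
  intros HT Ha Hc Hd HB Hf' H0.
  set (E := fun y => exists m t, 0 <= t <= T /\ y = f m t * exp (- (2 * a * t))).
  assert (HE : forall t, 0 <= t <= T -> 0 < exp (- (2 * a * t)) <= 1).
  { intros t Ht. split; [apply exp_pos|]. rewrite <- exp_0. apply exp_le.
    assert (0 <= 2 * a * t) by (repeat apply Rmult_le_pos; lra). lra. }
  assert (HEE : forall t, exp (- (2 * a * t)) * exp (2 * a * t) = 1).
  { intros t. rewrite <- exp_plus, <- exp_0. f_equal. ring. }
  destruct (completeness E) as [S [HS1 HS2]].
  - exists B. intros y (m & t & Ht & ->). specialize (HB m t Ht). specialize (HE t Ht).
    rewrite <- (Rmult_1_r B). apply Rmult_le_compat; lra.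
  - exists (f O 0 * exp (- (2 * a * 0))), O, 0. split; [lra|reflexivity].
  - assert (HS : forall m t, 0 <= t <= T -> f m t <= S * exp (2 * a * t)).
    { intros m t Ht. assert (Hm : f m t * exp (- (2 * a * t)) <= S)
        by (apply HS1; exists m, t; split; [assumption|reflexivity]).
      apply (Rmult_le_compat_r (exp (2 * a * t))) in Hm; [|left; apply exp_pos].
      rewrite Rmult_assoc, HEE, Rmult_1_r in Hm. exact Hm. }
    assert (HS0 : 0 <= S).
    { specialize (HS O 0 ltac:(lra)). specialize (HB O 0 ltac:(lra)).
      replace (2 * a * 0) with 0 in HS by ring. rewrite exp_0 in HS. lra. }
    assert (HYc : 0 <= Y0 + c * T).
    { specialize (HB O 0 ltac:(lra)). specialize (H0 O).
      assert (0 <= c * T) by (apply Rmult_le_pos; lra). lra. }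
    assert (HS' : S <= Y0 + c * T + S / 2).
    { apply HS2. intros y (m & t & Ht & ->).
      assert (Hm : f m t <= Y0 + c * T + S / 2 * exp (2 * a * t)).
      { set (g := fun r => f m r - S / 2 * exp (2 * a * r) - c * r).
        assert (Hg : g t - g 0 <= 0 * (t - 0)).
        { apply mean_value_le with
            (fun r => f' m r - S / 2 * (2 * a * exp (2 * a * r)) - c); [lra| |].
          - intros r Hr. unfold g.
            apply (is_derive_minus (fun r => f m r - S / 2 * exp (2 * a * r)) (fun r => c * r));
              [|auto_derive; [trivial|ring]].
            apply (is_derive_minus (f m) (fun r => S / 2 * exp (2 * a * r)));
              [apply Hd; lra|auto_derive; [trivial|ring]].
          - intros r Hr. pose proof (Hf' r (S * exp (2 * a * r)) ltac:(lra)
              (fun m => HS m r ltac:(lra)) m). lra. }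
        unfold g in Hg. replace (2 * a * 0) with 0 in Hg by ring. rewrite exp_0 in Hg.
        specialize (H0 m).
        assert (c * t <= c * T) by (apply Rmult_le_compat_l; lra). lra. }
      specialize (HE t Ht).
      apply (Rmult_le_compat_r (exp (- (2 * a * t)))) in Hm; [|lra].
      replace ((Y0 + c * T + S / 2 * exp (2 * a * t)) * exp (- (2 * a * t))) with
        ((Y0 + c * T) * exp (- (2 * a * t)) + S / 2 * (exp (- (2 * a * t)) * exp (2 * a * t)))
        in Hm by ring.
      rewrite HEE in Hm.
      assert ((Y0 + c * T) * exp (- (2 * a * t)) <= (Y0 + c * T) * 1)
        by (apply Rmult_le_compat_l; lra).
      lra. }
    intros m t Ht. eapply Rle_trans; [apply HS; assumption|].
    apply Rmult_le_compat_r; [left; apply exp_pos|lra].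
Qed.

Definition om (K k : nat) : R := INR (min (S k) K) ^ 3.

Lemma om_nonneg K k : 0 <= om K k.
Proof. apply pow_le, pos_INR. Qed.

Lemma om_le_K K k : om K k <= INR K ^ 3.
Proof. apply pow_incr. split; [apply pos_INR|apply le_INR; lia]. Qed.

Lemma om_le K k : om K k <= (1 + INR k) ^ 3.
Proof.
  rewrite Rplus_comm, <- S_INR. apply pow_incr. split; [apply pos_INR|apply le_INR; lia].
Qed.

Lemma om_resonance K k p q r : (k + q = p + r)%nat -> om K k <= 4 * (om K p + om K r).
Proof.
  intros E. unfold om.
  assert (H : INR (min (S k) K) <= INR (min (S p) K) + INR (min (S r) K))
    by (rewrite <- plus_INR; apply le_INR; lia).
  pose proof (pos_INR (min (S p) K)). pose proof (pos_INR (min (S r) K)).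
  set (x := INR (min (S p) K)) in *. set (y := INR (min (S r) K)) in *.
  apply Rle_trans with ((x + y) ^ 3).
  - apply pow_incr. split; [apply pos_INR|assumption].
  - assert (0 <= (x + y) * (x - y) ^ 2) by (apply Rmult_le_pos; [lra|apply pow2_ge_0]).
    simpl in *. lra.
Qed.

(** One half of the weighted AM-GM bound for 1/((1+q)(1+r)) when q or r is at least n. The large
    factor [nu] falls only on frequencies above n, whose tail sum is at most 1/n; with n = nu^2 the
    total mass is O(1/nu). *)
Definition psi (nu : R) (n q : nat) : R :=
  / 2 * (/ nu * inv2 q + nu * (if Nat.leb n q then inv2 q else 0)).

Lemma psi_nonneg nu n q : 0 < nu -> 0 <= psi nu n q.
Proof.
  intros H. pose proof (inv2_pos q). pose proof (Rinv_0_lt_compat _ H).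
  unfold psi. apply Rmult_le_pos; [lra|]. apply Rplus_le_le_0_compat.
  - apply Rmult_le_pos; lra.
  - apply Rmult_le_pos; [lra|]. destruct (Nat.leb n q); lra.
Qed.

Lemma Sum_psi J nu n : 0 < nu -> INR n = nu ^ 2 -> Sum J (psi nu n) <= 3 / 2 / nu.
Proof.
  intros Hnu Hn. unfold psi. rewrite Sum_scal, Sum_plus, !Sum_scal.
  assert (Hn1 : (1 <= n)%nat).
  { destruct n; [|lia]. simpl in Hn. assert (0 < nu * nu) by (apply Rmult_lt_0_compat; lra). lra. }
  pose proof (Sum_inv2 J). pose proof (Sum_inv2_tail J n Hn1) as HT. rewrite Hn in HT.
  assert (/ nu * Sum J inv2 <= / nu * 2)
    by (apply Rmult_le_compat_l; [left; now apply Rinv_0_lt_compat|assumption]).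
  assert (nu * Sum J (fun k => if Nat.leb n k then inv2 k else 0) <= / nu).
  { apply Rle_trans with (nu * / nu ^ 2); [apply Rmult_le_compat_l; lra|right; field; lra]. }
  lra.
Qed.

Lemma psi_lower nu n q r : 0 < nu -> (n <= q)%nat \/ (n <= r)%nat ->
  / ((1 + INR q) * (1 + INR r)) <= psi nu n q + psi nu n r.
Proof.
  assert (H : forall q r, 0 < nu -> (n <= r)%nat ->
    / ((1 + INR q) * (1 + INR r)) <= psi nu n q + psi nu n r).
  { clear. intros q r Hnu Hr. unfold psi.
    apply Nat.leb_le in Hr. rewrite Hr. unfold inv2.
    rewrite <- !pow_inv.
    rewrite Rinv_mult.
    set (i := / (1 + INR q)). set (j := / (1 + INR r)).
    pose proof (Rinv_0_lt_compat _ Hnu).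
    assert (E : 0 <= / nu * (i - nu * j) ^ 2) by (apply Rmult_le_pos; [lra|apply pow2_ge_0]).
    replace (/ nu * (i - nu * j) ^ 2) with (/ nu * i ^ 2 + nu * j ^ 2 - 2 * (i * j)) in E
      by (field; lra).
    assert (0 <= / nu * j ^ 2) by (apply Rmult_le_pos; [lra|apply pow2_ge_0]).
    assert (0 <= nu * (if Nat.leb n q then i ^ 2 else 0)).
    { apply Rmult_le_pos; [lra|]. destruct (Nat.leb n q); [apply pow2_ge_0|lra]. }
    lra. }
  intros Hnu [Hq|Hr]; [|now apply H].
  rewrite (Rmult_comm (1 + INR q)), (Rplus_comm (psi nu n q)). now apply H.
Qed.

Lemma inv2_mean k p : / ((1 + INR k) * (1 + INR p)) <= / 2 * (inv2 k + inv2 p).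
Proof.
  unfold inv2. rewrite <- !pow_inv, Rinv_mult.
  set (i := / (1 + INR k)). set (j := / (1 + INR p)).
  pose proof (pow2_ge_0 (i - j)). simpl in *. lra.
Qed.

Lemma amgm4 s X Y : 0 < s -> X * Y <= / 2 * (s * X ^ 2 + / s * Y ^ 2).
Proof.
  intros Hs. pose proof (Rinv_0_lt_compat _ Hs).
  assert (E : 0 <= / s * (s * X - Y) ^ 2) by (apply Rmult_le_pos; [lra|apply pow2_ge_0]).
  replace (/ s * (s * X - Y) ^ 2) with (s * X ^ 2 + / s * Y ^ 2 - 2 * (X * Y)) in E
    by (field; lra).
  lra.
Qed.

(* The resonant form is bounded by [log n] times the energy, up to a remainder
   which the [H^{1/2}] norm controls: when [q] or [r] is at least [n], the
   product is split as (g_k g_p)((1+q)(1+r))^{-1/2} times its mirror image. *)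
Lemma resonant_form_le (x : nat -> R) b Y K J :
  (1 <= K)%nat -> (forall k, 0 <= x k) ->
  (forall m, Sum m (fun k => (1 + INR k) * x k ^ 2) <= b) ->
  (forall m, Sum m (fun k => (om K k * x k) ^ 2) <= Y) ->
  Q4 J (fun k p q r => om K k * x k * (om K p * x p * (x q * x r))) <=
  b * (1 + 24 * ln (INR K)) * Y + 3 * b ^ 2.
Proof.
  intros HK Hx Hb HY.
  (* Removing the weight from two modes costs INR K ^ 6 each, and nu = K^12 compensates exactly.
     Then n = nu^2 = K^24 accounts for the 24 in front of the logarithm. *)
  set (nu := INR K ^ 12). set (n := ((K ^ 12) ^ 2)%nat).
  assert (HK1 : 1 <= INR K) by (apply le_INR in HK; simpl in HK; lra).
  assert (Hnu : 1 <= nu) by (apply pow_R1_Rle; assumption).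
  assert (Hn : INR n = nu ^ 2) by (unfold n, nu; rewrite !pow_INR; reflexivity).
  assert (Hn1 : (1 <= n)%nat).
  { apply INR_le. rewrite Hn. simpl INR at 1. apply pow_R1_Rle. assumption. }
  assert (Hln : ln (INR n) = 24 * ln (INR K)).
  { rewrite Hn. unfold nu. rewrite <- pow_mult, ln_pow by lra. simpl (12 * 2)%nat.
    f_equal. simpl; ring. }
  assert (Hb0 : 0 <= b) by apply (Hb O). assert (HY0 : 0 <= Y) by apply (HY O).
  set (y := fun k => om K k * x k).
  assert (Hy : forall k, 0 <= y k) by (intros; apply Rmult_le_pos; [apply om_nonneg|apply Hx]).
  set (l := fun q => if Nat.ltb q n then x q else 0).
  assert (Hl : forall q, 0 <= l q) by (intros q; unfold l; destruct (Nat.ltb q n); [apply Hx|lra]).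
  set (g := fun k => (1 + INR k) * y k ^ 2).
  set (h := fun k => (1 + INR k) * x k ^ 2).
  assert (Hg : forall k, 0 <= g k)
    by (intros; apply Rmult_le_pos; [left; apply INR1_pos|apply pow2_ge_0]).
  assert (Hh : forall k, 0 <= h k)
    by (intros; apply Rmult_le_pos; [left; apply INR1_pos|apply pow2_ge_0]).
  assert (Hy2 : forall k, 0 <= y k ^ 2) by (intros; apply pow2_ge_0).
  assert (Hinv2 : forall k, 0 <= inv2 k) by (intros; left; apply inv2_pos).
  assert (Hpsi : forall q, 0 <= psi nu n q) by (intros; apply psi_nonneg; lra).
  set (L := sqrt (b * (1 + 24 * ln (INR K)))).
  assert (HlnK : 0 <= ln (INR K)) by (rewrite <- ln_1; apply ln_le; lra).
  assert (HL0 : 0 <= L) by apply sqrt_pos.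
  assert (HLL : L * L = b * (1 + 24 * ln (INR K)))
    by (apply sqrt_sqrt, Rmult_le_pos; lra).
  assert (HlL : Sum J l <= L).
  { set (w := fun q => if Nat.ltb q n then sqrt (/ (1 + INR q)) else 0).
    set (v := fun q => sqrt (1 + INR q) * x q).
    rewrite (Sum_ext _ l (fun q => w q * v q)).
    - unfold L. rewrite Rmult_comm, sqrt_mult by lra.
      apply Sum_cauchy_schwarz; try apply sqrt_pos.
      + rewrite pow2_sqrt by lra.
        rewrite <- Hln. eapply Rle_trans; [|apply Sum_harmonic; assumption].
        apply Rle_trans with (Sum (max n J) (fun q => w q ^ 2)).
        { apply Sum_le_size; [lia|intros; apply pow2_ge_0]. }
        assert (E : forall m, Sum (m + n) (fun q => w q ^ 2) = Sum n (fun q => w q ^ 2)).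
        { induction m as [|m IH]; [reflexivity|]. cbn [Sum Nat.add]. rewrite IH.
          unfold w at 2. destruct (Nat.ltb_spec (m + n) n); [lia|]. simpl; ring. }
        replace (max n J) with ((max n J - n) + n)%nat by lia. rewrite E.
        apply Sum_le; intros q Hq. unfold w. destruct (Nat.ltb_spec q n); [|lia].
        rewrite pow2_sqrt; [lra|]. left; apply Rinv_0_lt_compat, INR1_pos.
      + rewrite pow2_sqrt by lra. eapply Rle_trans; [|apply (Hb J)].
        apply Sum_le; intros q _. unfold v.
        rewrite Rpow_mult_distr, pow2_sqrt; [lra|left; apply INR1_pos].
    - intros q _. unfold l, w, v. destruct (Nat.ltb q n); [|ring].
      rewrite <- Rmult_assoc, <- sqrt_mult_alt by (left; apply Rinv_0_lt_compat, INR1_pos).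
      rewrite Rinv_l by (pose proof (INR1_pos q); lra). rewrite sqrt_1. ring. }
  assert (HgG : Sum J g <= INR K ^ 6 * b).
  { eapply Rle_trans; [|apply Rmult_le_compat_l; [apply pow_le; lra|apply (Hb J)]].
    rewrite <- Sum_scal. apply Sum_le; intros k _. unfold g, y.
    rewrite Rpow_mult_distr.
    replace ((1 + INR k) * (om K k ^ 2 * x k ^ 2)) with (om K k ^ 2 * ((1 + INR k) * x k ^ 2)) by ring.
    apply Rmult_le_compat_r; [apply Hh|].
    replace (INR K ^ 6) with ((INR K ^ 3) ^ 2) by ring.
    apply pow_incr. split; [apply om_nonneg|apply om_le_K]. }
  assert (Hpt : forall k p q r, y k * (y p * (x q * x r)) <=
    / 2 * (y k ^ 2 * (l r * l q)) + / 2 * (y p ^ 2 * (l q * l r)) +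
    (/ 2 * (g k * (g p * psi nu n q)) + / 2 * (g p * (g k * psi nu n r)) +
    (/ 4 * (inv2 k * (h r * h q)) + / 4 * (inv2 p * (h q * h r))))).
  { intros k p q r.
    assert (P1 : 0 <= y k ^ 2 * (l r * l q)) by (apply Rmult_le_pos; [auto|apply Rmult_le_pos; auto]).
    assert (P2 : 0 <= y p ^ 2 * (l q * l r)) by (apply Rmult_le_pos; [auto|apply Rmult_le_pos; auto]).
    assert (P3 : 0 <= g k * (g p * psi nu n q)) by (apply Rmult_le_pos; [auto|apply Rmult_le_pos; auto]).
    assert (P4 : 0 <= g p * (g k * psi nu n r)) by (apply Rmult_le_pos; [auto|apply Rmult_le_pos; auto]).
    assert (P5 : 0 <= inv2 k * (h r * h q)) by (apply Rmult_le_pos; [auto|apply Rmult_le_pos; auto]).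
    assert (P6 : 0 <= inv2 p * (h q * h r)) by (apply Rmult_le_pos; [auto|apply Rmult_le_pos; auto]).
    destruct (le_lt_dec n q) as [Hq|Hq]; [|destruct (le_lt_dec n r) as [Hr|Hr]].
    3: { apply Nat.ltb_lt in Hq, Hr.
         replace (l q) with (x q) in * by (unfold l; now rewrite Hq).
         replace (l r) with (x r) in * by (unfold l; now rewrite Hr).
         assert (0 <= (x q * x r) * (y k - y p) ^ 2)
           by (apply Rmult_le_pos; [apply Rmult_le_pos; apply Hx|apply pow2_ge_0]).
         lra. }
    1, 2:
      assert (Hpl : / ((1 + INR q) * (1 + INR r)) <= psi nu n q + psi nu n r)
        by (apply psi_lower; [lra|tauto]);
      pose proof (inv2_mean k p) as Hil;
      pose proof (INR1_pos k); pose proof (INR1_pos p);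
      pose proof (INR1_pos q); pose proof (INR1_pos r);
      set (s := (1 + INR k) * (1 + INR p) / ((1 + INR q) * (1 + INR r)));
      assert (Hs : 0 < s) by (apply Rdiv_lt_0_compat; apply Rmult_lt_0_compat; assumption);
      pose proof (amgm4 s (y k * y p) (x q * x r) Hs) as HA;
      assert (Z1 : s * (y k * y p) ^ 2 <= g k * g p * (psi nu n q + psi nu n r));
      [ replace (s * (y k * y p) ^ 2) with (g k * g p * / ((1 + INR q) * (1 + INR r)))
          by (unfold s, g; field; lra);
        apply Rmult_le_compat_l; [apply Rmult_le_pos; auto|assumption]
      | assert (Z2 : / s * (x q * x r) ^ 2 <= h q * h r * (/ 2 * (inv2 k + inv2 p)));
        [ replace (/ s * (x q * x r) ^ 2) with (h q * h r * / ((1 + INR k) * (1 + INR p)))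
            by (unfold s, h; field; lra);
          apply Rmult_le_compat_l; [apply Rmult_le_pos; auto|assumption]
        | lra ] ]. }
  apply Rle_trans with (1 := Q4_le J _ _ (fun k p q r _ => Hpt k p q r)).
  rewrite !Q4_plus, !Q4_scal.
  pose proof (Q4_omit_p J (fun k => y k ^ 2) l l Y L L Hy2 Hl Hl (HY J) HlL HlL) as B1.
  pose proof (Q4_omit_k J (fun k => y k ^ 2) l l Y L L Hy2 Hl Hl (HY J) HlL HlL) as B2.
  assert (Hps : Sum J (psi nu n) <= 3 / 2 / nu) by (apply Sum_psi; [lra|assumption]).
  pose proof (Q4_omit_r J g g (psi nu n) _ _ _ Hg Hg Hpsi HgG HgG Hps) as B3.
  pose proof (Q4_omit_q J g g (psi nu n) _ _ _ Hg Hg Hpsi HgG HgG Hps) as B4.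
  pose proof (Q4_omit_p J inv2 h h _ _ _ Hinv2 Hh Hh (Sum_inv2 J) (Hb J) (Hb J)) as B5.
  pose proof (Q4_omit_k J inv2 h h _ _ _ Hinv2 Hh Hh (Sum_inv2 J) (Hb J) (Hb J)) as B6.
  replace (INR K ^ 6 * b * (INR K ^ 6 * b * (3 / 2 / nu))) with (3 / 2 * b ^ 2) in B3, B4
    by (unfold nu; field; lra).
  rewrite HLL in B1, B2. pose proof (pow2_ge_0 b). lra.
Qed.

Section ShortTime.
Variables (u d : R -> nat -> C) (T b : R).
Hypothesis Hflow : flow u d.
Hypothesis HT0 : 0 <= T.
Hypothesis Hb1 : 1 <= b.
Hypothesis Hb : forall t, 0 <= t <= T -> H12_le (u t) b.

(** One of the two factors [om K k] moves by resonance to p or r at the price 4; the two cases agree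
    under exchanging p and r, whence 8. *)
Lemma energy_rate K t Y m : (1 <= K)%nat -> 0 <= t <= T ->
  (forall n, Sum n (fun k => (om K k * Cmod (u t k)) ^ 2) <= Y) ->
  Sum m (fun k => om K k ^ 2 * Cmod (u t k) * Cmod (d t k)) <=
  8 * (b * (1 + 24 * ln (INR K)) * Y + 3 * b ^ 2).
Proof.
  intros HK Ht HY.
  apply (flow_rate_le u d Hflow t (fun k => om K k ^ 2 * Cmod (u t k))).
  { intros k. apply Rmult_le_pos; [apply pow2_ge_0|apply Cmod_ge_0]. }
  intros J. set (x := fun k => Cmod (u t k)).
  assert (Hx : forall k, 0 <= x k) by (intros; apply Cmod_ge_0).
  pose proof (resonant_form_le x b Y K J HK Hx (Hb t Ht) HY) as HR.
  apply Rle_trans with (Q4 J (fun k p q r =>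
    4 * (om K k * x k * (om K p * x p * (x q * x r))) +
    4 * (om K k * x k * (om K r * x r * (x q * x p))))).
  - apply Q4_le. intros k p q r E. fold (x k) (x p) (x q) (x r).
    pose proof (om_resonance K k p q r E) as Ho.
    assert (P : 0 <= om K k * x k * (x p * (x q * x r)))
      by (apply Rmult_le_pos; apply Rmult_le_pos; auto using om_nonneg, Rmult_le_pos).
    apply (Rmult_le_compat_l _ _ _ P) in Ho. lra.
  - rewrite Q4_plus, !Q4_scal.
    rewrite (Q4_sym_pr J (fun k p q r => om K k * x k * (om K r * x r * (x q * x p)))). lra.
Qed.

(** The cap follows the mode: K = k + 1. The energy grows by at most exp(32 b (1 + 24 ln K) t), and
    since 768 = 32 * 24 this is at most e K on the interval. So K^6 |u_k|^2 = O(K), more than enough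
    for decay like K^{-2}. *)
Lemma short_time_decay C0 :
  T * (768 * b) <= 1 ->
  (forall k, Cmod (u 0 k) * (1 + INR k) ^ 4 <= C0) ->
  exists C1, forall t, 0 <= t <= T -> forall k, Cmod (u t k) <= C1 * inv2 k.
Proof.
  intros HT HC0.
  (* The factor 2 of [gronwall_family] times the 3 bounding e; 2 C0^2 bounds the initial energy and
     48 b^2 is twice the remainder in [energy_rate]. *)
  set (A := 6 * (2 * C0 ^ 2 + 48 * b ^ 2 * T)).
  assert (HA : 0 <= A).
  { unfold A. pose proof (pow2_ge_0 C0).
    assert (0 <= b ^ 2 * T) by (apply Rmult_le_pos; [apply pow2_ge_0|assumption]). lra. }
  exists (sqrt A). intros t Ht k. set (K := S k).
  assert (HK : 1 <= INR K) by (unfold K; rewrite S_INR; pose proof (pos_INR k); lra).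
  assert (HlnK : 0 <= ln (INR K)) by (rewrite <- ln_1; apply ln_le; lra).
  set (f := fun m s => Sum m (fun k => (om K k * Cmod (u s k)) ^ 2)).
  set (f' := fun m s => Sum m (fun k => om K k ^ 2 *
     (2 * (fst (u s k) * fst (d s k) + snd (u s k) * snd (d s k))))).
  assert (Hsq : forall s k, (om K k * Cmod (u s k)) ^ 2 =
     om K k ^ 2 * (fst (u s k) * fst (u s k) + snd (u s k) * snd (u s k))).
  { intros s j. rewrite Cmod_dot. ring. }
  assert (HG : f K t <= 2 * (2 * C0 ^ 2 + 48 * b ^ 2 * T) *
             exp (2 * (16 * b * (1 + 24 * ln (INR K))) * t)).
  { apply (gronwall_family f f' T (16 * b * (1 + 24 * ln (INR K))) (48 * b ^ 2)
      (2 * C0 ^ 2) (INR K ^ 6 * b)); try assumption.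
    - apply Rmult_le_pos; lra.
    - pose proof (pow2_ge_0 b). lra.
    - intros m s Hs. unfold f, f'.
      apply (is_derive_Sum m (fun j r => (om K j * Cmod (u r j)) ^ 2)). intros j.
      apply is_derive_ext with (fun r => om K j ^ 2 *
        (fst (u r j) * fst (u r j) + snd (u r j) * snd (u r j)));
        [intros r; symmetry; apply Hsq|].
      apply (is_derive_scal (fun r => fst (u r j) * fst (u r j) + snd (u r j) * snd (u r j))).
      destruct Hflow as (_ & H2 & _). destruct (H2 s j) as [Hr Hi].
      replace (2 * _) with
        ((fst (d s j) * fst (u s j) + fst (u s j) * fst (d s j)) +
         (snd (d s j) * snd (u s j) + snd (u s j) * snd (d s j))) by ring.
      apply (is_derive_plus (fun r => fst (u r j) * fst (u r j)));
        [apply (is_derive_mult (fun r => fst (u r j)) (fun r => fst (u r j)))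
        |apply (is_derive_mult (fun r => snd (u r j)) (fun r => snd (u r j)))];
        try assumption; apply Rmult_comm.
    - intros m s Hs. split; [apply Sum_sqr_nonneg|].
      eapply Rle_trans; [|apply Rmult_le_compat_l; [apply pow_le; lra|apply (Hb s Hs m)]].
      rewrite <- Sum_scal. apply Sum_le; intros j _.
      rewrite Rpow_mult_distr. replace (INR K ^ 6) with ((INR K ^ 3) ^ 2) by ring.
      apply Rmult_le_compat; try apply pow2_ge_0.
      + apply pow_incr. split; [apply om_nonneg|apply om_le_K].
      + rewrite <- (Rmult_1_l (Cmod (u s j) ^ 2)) at 1.
        apply Rmult_le_compat_r; [apply pow2_ge_0|]. pose proof (pos_INR j). lra.
    - intros s Y Hs HY m.
      pose proof (energy_rate K s Y m ltac:(unfold K; lia) Hs HY) as HE.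
      apply Rle_trans with (2 * Sum m (fun k => om K k ^ 2 * Cmod (u s k) * Cmod (d s k))); [|lra].
      rewrite <- Sum_scal. apply Sum_le; intros j _.
      pose proof (dot_le_Cmod (u s j) (d s j)) as HD.
      apply (Rmult_le_compat_l (2 * om K j ^ 2)) in HD;
        [lra|pose proof (pow2_ge_0 (om K j)); lra].
    - intros m. apply Rle_trans with (C0 ^ 2 * Sum m inv2).
      + rewrite <- Sum_scal. apply Sum_le; intros j _.
        pose proof (INR1_pos j) as Hj.
        replace (C0 ^ 2 * inv2 j) with ((C0 * / (1 + INR j)) ^ 2)
          by (unfold inv2; field; lra).
        apply pow_incr. split; [apply Rmult_le_pos; [apply om_nonneg|apply Cmod_ge_0]|].
        apply Rmult_le_reg_r with (1 + INR j); [assumption|].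
        rewrite (Rmult_assoc C0), Rinv_l, Rmult_1_r by lra.
        eapply Rle_trans; [|apply (HC0 j)].
        replace (Cmod (u 0 j) * (1 + INR j) ^ 4) with
          ((1 + INR j) ^ 3 * Cmod (u 0 j) * (1 + INR j)) by ring.
        apply Rmult_le_compat_r; [lra|]. apply Rmult_le_compat_r; [apply Cmod_ge_0|apply om_le].
      + rewrite (Rmult_comm 2). apply Rmult_le_compat_l; [apply pow2_ge_0|apply Sum_inv2]. }
  assert (Hexp : exp (2 * (16 * b * (1 + 24 * ln (INR K))) * t) <= 3 * INR K).
  { apply Rle_trans with (exp (1 + ln (INR K))).
    - apply exp_le.
      assert (E : t * (768 * b) <= 1).
      { eapply Rle_trans; [|exact HT]. apply Rmult_le_compat_r; lra. }
      apply (Rmult_le_compat_r (1 + 24 * ln (INR K))) in E; lra.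
    - rewrite exp_plus, exp_ln by lra. apply Rmult_le_compat_r; [lra|apply exp_le_3]. }
  assert (Hf : (INR K ^ 3 * Cmod (u t k)) ^ 2 <= f K t).
  { unfold f, K at 2. cbn [Sum]. unfold om at 2. rewrite Nat.min_id.
    fold K. pose proof (Sum_sqr_nonneg k (fun j => om K j * Cmod (u t j))). unfold K in *. lra. }
  assert (Hfin : (INR K ^ 3 * Cmod (u t k)) ^ 2 <= A * INR K).
  { eapply Rle_trans; [exact Hf|]. eapply Rle_trans; [exact HG|].
    unfold A. eapply Rle_trans; [apply Rmult_le_compat_l; [|exact Hexp]|].
    - unfold A in HA. lra.
    - lra. }
  assert (HK2 : (INR K ^ 2 * Cmod (u t k)) ^ 2 <= A).
  { apply Rmult_le_reg_r with (INR K); [lra|].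
    eapply Rle_trans; [|exact Hfin].
    replace ((INR K ^ 3 * Cmod (u t k)) ^ 2) with
      ((INR K ^ 2 * Cmod (u t k)) ^ 2 * INR K ^ 2) by ring.
    apply Rmult_le_compat_l; [apply pow2_ge_0|].
    clearbody K. nra. }
  apply sqrt_le_1_alt in HK2. rewrite sqrt_pow2 in HK2
    by (apply Rmult_le_pos; [apply pow_le; lra|apply Cmod_ge_0]).
  unfold inv2. rewrite (Rplus_comm 1), <- S_INR. fold K.
  apply Rmult_le_reg_r with (INR K ^ 2); [apply pow_lt; lra|].
  rewrite Rmult_assoc, Rinv_l by (apply pow_nonzero; lra). lra.
Qed.
End ShortTime.

(** * Trace norm and the Lax pair *)

Definition mx := nat -> nat -> C.

Definition norm2 (N : nat) (x : nat -> C) : R := Sum N (fun i => Cmod (x i) ^ 2).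

Definition mulv (N : nat) (A : mx) (x : nat -> C) (j : nat) : C :=
  CSum N (fun l => Cmult (A j l) (x l)).

(* [nuc N X c]: the [N x N] matrix [X] is a finite sum of rank-one matrices
   [x y^T] with [sum |x| |y| <= c], i.e. its trace norm is at most [c]. *)
Inductive nuc (N : nat) : mx -> R -> Prop :=
| nuc_zero X c : (forall j k, (j < N)%nat -> (k < N)%nat -> X j k = RtoC 0) -> 0 <= c ->
    nuc N X c
| nuc_add X X' x y a b c c' : nuc N X c -> 0 <= a -> 0 <= b ->
    norm2 N x <= a ^ 2 -> norm2 N y <= b ^ 2 ->
    (forall j k, (j < N)%nat -> (k < N)%nat -> X' j k = Cplus (X j k) (Cmult (x j) (y k))) ->
    c + a * b <= c' -> nuc N X' c'.

Lemma nuc_le N X c c' : nuc N X c -> c <= c' -> nuc N X c'.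
Proof.
  intros H Hc. destruct H as [X c HX H0|X X' x y a b c0 c H Ha Hb Hx Hy HX Hc0].
  - apply nuc_zero; [assumption|lra].
  - apply nuc_add with X x y a b c0; try assumption. lra.
Qed.

Lemma nuc_ext N X Y c : nuc N X c ->
  (forall j k, (j < N)%nat -> (k < N)%nat -> Y j k = X j k) -> nuc N Y c.
Proof.
  intros H HY. destruct H as [X c HX H0|X X' x y a b c0 c H Ha Hb Hx Hy HX Hc0].
  - apply nuc_zero; [|assumption]. intros. rewrite HY; auto.
  - apply nuc_add with X x y a b c0; try assumption. intros. rewrite HY; auto.
Qed.

Lemma Sum_shift n s f : Sum (s + n) f = Sum s f + Sum n (fun i => f (s + i)%nat).
Proof.
  induction n as [|n IH]; [rewrite Nat.add_0_r; simpl; ring|].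
  rewrite Nat.add_succ_r. cbn [Sum]. rewrite IH. ring.
Qed.

(** A rank-one piece x y^T contributes the sum of |x_k| |y_{s+k}| to the shifted diagonal, at most
    |x| |y| by Cauchy-Schwarz. *)
Lemma nuc_diagonal N X c s n : nuc N X c -> (s + n <= N)%nat ->
  Sum n (fun k => Cmod (X k (s + k)%nat)) <= c.
Proof.
  intros H Hn. induction H as [X c HX H0|X X' x y a b c c' H IH Ha Hb Hx Hy HX Hc].
  - erewrite Sum_ext; [rewrite Sum_zero; exact H0|].
    intros k Hk. cbv beta. rewrite HX by lia. apply Cmod_0.
  - eapply Rle_trans; [|exact Hc].
    apply Rle_trans with (Sum n (fun k => Cmod (X k (s + k)%nat) + Cmod (x k) * Cmod (y (s + k)%nat))).
    + apply Sum_le; intros k Hk. rewrite HX by lia. rewrite <- Cmod_mult. apply Cmod_triangle.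
    + rewrite Sum_plus. apply Rplus_le_compat; [assumption|].
      apply Sum_cauchy_schwarz; try assumption.
      * eapply Rle_trans; [|exact Hx]. apply Sum_le_size; [lia|intros; apply pow2_ge_0].
      * eapply Rle_trans; [|exact Hy]. unfold norm2.
        apply Rle_trans with (Sum (s + n) (fun i => Cmod (y i) ^ 2)).
        -- rewrite Sum_shift. pose proof (Sum_sqr_nonneg s (fun i => Cmod (y i))). lra.
        -- apply Sum_le_size; [lia|intros; apply pow2_ge_0].
Qed.

(** This is G X G^T, with the transpose rather than the adjoint, as the Lax equation requires; it
    maps x y^T to (Gx)(Gy)^T. *)
Definition congr (N : nat) (G X : mx) : mx :=
  fun j k => CSum N (fun l => CSum N (fun m => Cmult (Cmult (G j l) (X l m)) (G k m))).

Lemma nuc_congr N G X c g : 0 <= g ->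
  (forall x, norm2 N (mulv N G x) <= g ^ 2 * norm2 N x) ->
  nuc N X c -> nuc N (congr N G X) (g ^ 2 * c).
Proof.
  intros Hg HG H. induction H as [X c HX H0|X X' x y a b c c' H IH Ha Hb Hx Hy HX Hc].
  - apply nuc_zero; [|apply Rmult_le_pos; [apply pow2_ge_0|assumption]].
    intros j k _ _. unfold congr. rewrite (CSum_ext _ _ (fun _ => RtoC 0)), CSum_zero; [reflexivity|].
    intros l Hl. rewrite (CSum_ext _ _ (fun _ => RtoC 0)), CSum_zero; [reflexivity|].
    intros m Hm. rewrite HX by assumption. ring.
  - assert (Hs : forall z r, norm2 N z <= r ^ 2 -> norm2 N (mulv N G z) <= (g * r) ^ 2).
    { intros z r Hz. eapply Rle_trans; [apply HG|]. rewrite Rpow_mult_distr.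
      apply Rmult_le_compat_l; [apply pow2_ge_0|assumption]. }
    apply nuc_add with (congr N G X) (mulv N G x) (mulv N G y) (g * a) (g * b) (g ^ 2 * c);
      auto using Rmult_le_pos.
    + intros j k _ _. unfold congr, mulv.
      rewrite (Cmult_comm (CSum N _)), <- CSum_scal, <- CSum_plus.
      apply CSum_ext; intros l Hl.
      rewrite (Cmult_comm _ (Cmult (G j l) (x l))), <- CSum_scal, <- CSum_plus.
      apply CSum_ext; intros m Hm. rewrite HX by assumption. ring.
    + replace (g ^ 2 * c + g * a * (g * b)) with (g ^ 2 * (c + a * b)) by ring.
      apply Rmult_le_compat_l; [apply pow2_ge_0|assumption].
Qed.

Lemma norm2_le_sqr_Sum N y : norm2 N y <= (Sum N (fun k => Cmod (y k))) ^ 2.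
Proof. apply (Sum_sqr_le N (fun k => Cmod (y k))). intros; apply Cmod_ge_0. Qed.

(** The perturbation is added row by row, the n-th row being the rank-one matrix e_n E_n^T; thus the
    entrywise l^1 norm dominates the trace norm. *)
Lemma nuc_perturb N X E c : nuc N X c ->
  nuc N (fun j k => Cplus (X j k) (E j k)) (c + Sum N (fun j => Sum N (fun k => Cmod (E j k)))).
Proof.
  intros H.
  assert (Hn : forall n, (n <= N)%nat ->
    nuc N (fun j k => if Nat.ltb j n then Cplus (X j k) (E j k) else X j k)
      (c + Sum n (fun j => Sum N (fun k => Cmod (E j k))))).
  { induction n as [|n IH]; intros Hn.
    - simpl. apply nuc_le with c; [|lra]. apply (nuc_ext _ _ _ _ H). reflexivity.
    - apply nuc_add with (2 := Rle_0_1) (1 := IH ltac:(lia))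
        (x := fun j => if Nat.eqb j n then RtoC 1 else RtoC 0) (y := E n)
        (b := Sum N (fun k => Cmod (E n k))).
      + apply Sum_nonneg; intros; apply Cmod_ge_0.
      + unfold norm2. rewrite (Sum_ext _ _ (fun j => if Nat.eqb j n then 1 else 0)).
        * eapply Rle_trans; [apply (Sum_single_le N (fun j => Nat.eqb j n)); [lra|]|lra].
          intros i j. rewrite !Nat.eqb_eq. lia.
        * intros j _. destruct (Nat.eqb j n); [rewrite Cmod_1|rewrite Cmod_0]; ring.
      + apply norm2_le_sqr_Sum.
      + intros j k _ _. destruct (Nat.ltb_spec j (S n)), (Nat.ltb_spec j n), (Nat.eqb_spec j n);
          try lia; try (subst j; ring); ring.
      + cbn [Sum]. lra. }
  apply (nuc_ext _ _ _ _ (Hn N (le_n N))). intros j k Hj _.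
  destruct (Nat.ltb_spec j N); [reflexivity|lia].
Qed.

Lemma CSum_reindex N k F : (forall r, (N <= r)%nat -> F r = RtoC 0) ->
  CSum N (fun r => if Nat.leb k r then F r else RtoC 0) = CSum N (fun l => F (l + k)%nat).
Proof.
  intros HF.
  assert (E : forall n, CSum (n + k) (fun r => if Nat.leb k r then F r else RtoC 0) =
                        CSum n (fun l => F (l + k)%nat)).
  { induction n as [|n IH]; cbn [CSum Nat.add].
    - rewrite (CSum_ext _ _ (fun _ => RtoC 0)), CSum_zero; [reflexivity|].
      intros i Hi. destruct (Nat.leb_spec k i); [lia|reflexivity].
    - rewrite IH. destruct (Nat.leb_spec k (n + k)); [reflexivity|lia]. }
  rewrite <- E. symmetry. apply CSum_pad; [lia|].
  intros i Hi. rewrite HF by assumption. now destruct (Nat.leb k i).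
Qed.

(** * The Lax pair for finitely supported states *)

Section Lax.
Variables (N : nat) (v : nat -> C).
Hypothesis Hv : forall n, (N <= n)%nat -> v n = RtoC 0.

(** The Toeplitz matrix of |v|^2: the entry is the Fourier coefficient of |v|^2 at j - l. *)
Definition toeplitz : mx := fun j l =>
  CSum N (fun p => CSum N (fun q =>
    if Nat.eqb (j + q) (p + l) then Cmult (v p) (Cconj (v q)) else RtoC 0)).

(** The matrix H H^* for the Hankel matrix H of [v]. *)
Definition hankel_sq : mx := fun j l =>
  CSum N (fun a => Cmult (v (j + a)%nat) (Cconj (v (a + l)%nat))).

Lemma cubic_vanish p q r : (N <= p)%nat \/ (N <= q)%nat \/ (N <= r)%nat ->
  cubic v p q r = RtoC 0.
Proof.
  unfold cubic. intros [H|[H|H]]; rewrite (Hv _ H); [ring| |ring].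
  replace (Cconj (RtoC 0)) with (RtoC 0) by (apply injective_projections; simpl; ring). ring.
Qed.

Lemma rect_pad J L k : (N <= J)%nat -> (N <= L)%nat -> rect J L v k = rect N N v k.
Proof.
  intros HJ HL. unfold rect.
  assert (Z : forall p q r, (N <= p)%nat \/ (N <= q)%nat \/ (N <= r)%nat ->
    (if Nat.eqb (k + q) (p + r) then cubic v p q r else RtoC 0) = RtoC 0).
  { intros p q r H. rewrite cubic_vanish by assumption. now destruct (Nat.eqb _ _). }
  rewrite (CSum_pad N J) by (lia || (intros q Hq;
    rewrite (CSum_ext _ _ (fun _ => RtoC 0)); [apply CSum_zero|intros p _;
    rewrite (CSum_ext _ _ (fun _ => RtoC 0)); [apply CSum_zero|intros r _; auto]])).
  apply CSum_ext; intros q _.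
  rewrite (CSum_pad N L) by (lia || (intros p Hp;
    rewrite (CSum_ext _ _ (fun _ => RtoC 0)); [apply CSum_zero|intros r _; auto])).
  apply CSum_ext; intros p _.
  apply CSum_pad; [lia|]. intros r Hr. auto.
Qed.

Lemma rect_series k : is_series (szego_term v k) (rect N N v k).
Proof.
  apply filterlim_ext_loc with (fun _ : nat => rect N N v k); [|apply filterlim_const].
  exists N. intros n Hn.
  transitivity (rect (S n) (k + n + 1 + N) v k); symmetry.
  - apply rect_pad; lia.
  - apply szego_partial_sum; lia.
Qed.

(* On [j + k + q = p + r] one has [r >= k] or [p >= j]; the terms with [r >= k]
   form [T H], those with [p >= j] form [H T^T], and the overlap is [H H^* H]. *)
Lemma hankel_cubic j k :
  rect N N v (j + k) =
  Cminus (Cplus (CSum N (fun l => Cmult (toeplitz j l) (v (l + k)%nat)))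
                (CSum N (fun l => Cmult (v (j + l)%nat) (toeplitz k l))))
         (CSum N (fun l => Cmult (hankel_sq j l) (v (l + k)%nat))).
Proof.
  set (t := fun p q r => if Nat.eqb (j + k + q) (p + r) then cubic v p q r else RtoC 0).
  assert (Z : forall p q r, (N <= p)%nat \/ (N <= q)%nat \/ (N <= r)%nat -> t p q r = RtoC 0).
  { intros p q r H. unfold t. rewrite cubic_vanish by assumption. now destruct (Nat.eqb _ _). }
  transitivity (Cminus (Cplus
    (CSum N (fun q => CSum N (fun p => CSum N (fun r => if Nat.leb k r then t p q r else RtoC 0))))
    (CSum N (fun q => CSum N (fun p => CSum N (fun r => if Nat.leb j p then t p q r else RtoC 0)))))
    (CSum N (fun q => CSum N (fun p => CSum N (fun r =>
       if Nat.leb j p then if Nat.leb k r then t p q r else RtoC 0 else RtoC 0))))).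
  { unfold rect. rewrite <- CSum_plus, <- CSum_minus. apply CSum_ext; intros q _.
    rewrite <- CSum_plus, <- CSum_minus. apply CSum_ext; intros p _.
    rewrite <- CSum_plus, <- CSum_minus. apply CSum_ext; intros r _.
    unfold t. destruct (Nat.eqb_spec (j + k + q) (p + r)) as [E|E].
    - destruct (Nat.leb_spec j p), (Nat.leb_spec k r); try lia; ring.
    - destruct (Nat.leb j p), (Nat.leb k r); ring. }
  f_equal; [f_equal|].
  - transitivity (CSum N (fun q => CSum N (fun p => CSum N (fun l => t p q (l + k)%nat)))).
    { apply CSum_ext; intros q _. apply CSum_ext; intros p _.
      apply CSum_reindex. intros r Hr. apply Z; auto. }
    rewrite CSum_swap.
    erewrite CSum_ext by (intros p _; rewrite CSum_swap; reflexivity).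
    rewrite CSum_swap. apply CSum_ext; intros l _.
    unfold toeplitz. rewrite Cmult_comm, <- CSum_scal. apply CSum_ext; intros p _.
    rewrite <- CSum_scal. apply CSum_ext; intros q _. unfold t.
    destruct (Nat.eqb_spec (j + k + q) (p + (l + k))), (Nat.eqb_spec (j + q) (p + l));
      try lia; [unfold cubic; ring|ring].
  - transitivity (CSum N (fun q => CSum N (fun l => CSum N (fun r => t (l + j)%nat q r)))).
    { apply CSum_ext; intros q _. rewrite CSum_swap.
      rewrite (CSum_swap N N (fun l r => t (l + j)%nat q r)).
      apply CSum_ext; intros r _.
      apply (CSum_reindex N j (fun p => t p q r)). intros p Hp. apply Z; auto. }
    rewrite CSum_swap. apply CSum_ext; intros l _.
    rewrite CSum_swap.
    unfold toeplitz. rewrite <- CSum_scal. apply CSum_ext; intros r _.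
    rewrite <- CSum_scal. apply CSum_ext; intros q _. unfold t. rewrite (Nat.add_comm l j).
    destruct (Nat.eqb_spec (j + k + q) (j + l + r)), (Nat.eqb_spec (k + q) (r + l));
      try lia; [unfold cubic; ring|ring].
  - transitivity (CSum N (fun q => CSum N (fun a => CSum N (fun l => t (a + j)%nat q (l + k)%nat)))).
    { apply CSum_ext; intros q _.
      rewrite <- (CSum_reindex N j (fun p => CSum N (fun l => t p q (l + k)%nat))).
      - apply CSum_ext; intros p _. destruct (Nat.leb j p).
        + apply CSum_reindex. intros r Hr. apply Z; auto.
        + apply CSum_zero.
      - intros p Hp. rewrite (CSum_ext _ _ (fun _ => RtoC 0)); [apply CSum_zero|].
        intros l _. apply Z; auto. }
    rewrite CSum_swap.
    transitivity (CSum N (fun a => CSum N (fun l =>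
      Cmult (Cmult (v (j + a)%nat) (Cconj (v (a + l)%nat))) (v (l + k)%nat)))).
    { apply CSum_ext; intros a _. rewrite CSum_swap. apply CSum_ext; intros l _.
      destruct (le_lt_dec N (a + l)) as [Hal|Hal].
      - rewrite (Hv _ Hal).
        replace (Cconj (RtoC 0)) with (RtoC 0) by (apply injective_projections; simpl; ring).
        rewrite (CSum_ext _ _ (fun _ => RtoC 0)), CSum_zero; [ring|].
        intros q Hq. unfold t.
        destruct (Nat.eqb_spec (j + k + q) (a + j + (l + k))); [lia|reflexivity].
      - transitivity (CSum N (fun q => if Nat.eqb (a + l) (0 + q)
          then cubic v (a + j) q (l + k) else RtoC 0)).
        + apply CSum_ext; intros q _. unfold t.
          destruct (Nat.eqb_spec (j + k + q) (a + j + (l + k))), (Nat.eqb_spec (a + l) (0 + q));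
            try lia; reflexivity.
        + rewrite (CSum_delta N (a + l) 0 (fun q => cubic v (a + j) q (l + k)) Hal).
          simpl. rewrite Nat.sub_0_r. unfold cubic. now rewrite (Nat.add_comm a j). }
    rewrite CSum_swap. apply CSum_ext; intros l _.
    unfold hankel_sq. rewrite Cmult_comm, <- CSum_scal. apply CSum_ext; intros a _. ring.
Qed.

(** The overlap H H^* H is subtracted once in [hankel_cubic]; the factor 1/2 charges it equally to
    both sides, so that one and the same Hermitian matrix acts on the left and, transposed, on the
    right. *)
Definition lax_sym : mx := fun j l =>
  Cminus (toeplitz j l) (Cmult (RtoC (/ 2)) (hankel_sq j l)).

Definition lax : mx := fun j l => Cmult (Copp Ci) (lax_sym j l).

Lemma lax_sym_hermitian j l : Cconj (lax_sym l j) = lax_sym j l.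
Proof.
  unfold lax_sym, Cminus. rewrite Cplus_conj, Copp_conj, Cmult_conj.
  replace (Cconj (RtoC (/ 2))) with (RtoC (/ 2)) by (apply injective_projections; simpl; ring).
  f_equal; [|do 2 f_equal].
  - unfold toeplitz. rewrite Cconj_CSum.
    erewrite CSum_ext by (intros p _; rewrite Cconj_CSum; reflexivity).
    rewrite CSum_swap. apply CSum_ext; intros p _. apply CSum_ext; intros q _.
    destruct (Nat.eqb_spec (l + p) (q + j)), (Nat.eqb_spec (j + q) (p + l)); try lia.
    + rewrite Cmult_conj, Cconj_conj. ring.
    + apply injective_projections; simpl; ring.
  - unfold hankel_sq. rewrite Cconj_CSum. apply CSum_ext; intros a _.
    rewrite Cmult_conj, Cconj_conj, (Nat.add_comm l a), (Nat.add_comm a j). ring.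
Qed.

(** H is symmetric, so H times the transpose of H H^* equals H H^* H. This is why the overlap can be
    divided between the two sides. *)
Lemma lax_equation j k :
  Cmult (Copp Ci) (rect N N v (j + k)) =
  Cplus (CSum N (fun l => Cmult (lax j l) (v (l + k)%nat)))
        (CSum N (fun l => Cmult (v (j + l)%nat) (lax k l))).
Proof.
  rewrite hankel_cubic.
  assert (E : CSum N (fun l => Cmult (v (j + l)%nat) (hankel_sq k l)) =
              CSum N (fun l => Cmult (hankel_sq j l) (v (l + k)%nat))).
  { unfold hankel_sq.
    transitivity (CSum N (fun l => CSum N (fun a =>
      Cmult (v (j + l)%nat) (Cmult (v (k + a)%nat) (Cconj (v (a + l)%nat)))))).
    - apply CSum_ext; intros l _. now rewrite CSum_scal.
    - rewrite CSum_swap. apply CSum_ext; intros a _.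
      rewrite Cmult_comm, <- CSum_scal. apply CSum_ext; intros l _.
      rewrite (Nat.add_comm k a), (Nat.add_comm l a). ring. }
  assert (E1 : CSum N (fun l => Cmult (lax j l) (v (l + k)%nat)) =
    Cmult (Copp Ci) (Cminus (CSum N (fun l => Cmult (toeplitz j l) (v (l + k)%nat)))
      (Cmult (RtoC (/ 2)) (CSum N (fun l => Cmult (hankel_sq j l) (v (l + k)%nat)))))).
  { rewrite <- CSum_scal, <- CSum_minus, <- CSum_scal.
    apply CSum_ext; intros l _. unfold lax, lax_sym. ring. }
  assert (E2 : CSum N (fun l => Cmult (v (j + l)%nat) (lax k l)) =
    Cmult (Copp Ci) (Cminus (CSum N (fun l => Cmult (v (j + l)%nat) (toeplitz k l)))
      (Cmult (RtoC (/ 2)) (CSum N (fun l => Cmult (v (j + l)%nat) (hankel_sq k l)))))).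
  { rewrite <- CSum_scal, <- CSum_minus, <- CSum_scal.
    apply CSum_ext; intros l _. unfold lax, lax_sym. ring. }
  rewrite E1, E2, E.
  set (h := CSum N (fun l => Cmult (hankel_sq j l) (v (l + k)%nat))).
  replace h with (Cplus (Cmult (RtoC (/ 2)) h) (Cmult (RtoC (/ 2)) h)) at 1
    by (apply injective_projections; simpl; field).
  ring.
Qed.

(** The sum is the real part of -i W, where W is the quadratic form of a Hermitian matrix and hence
    real. *)
Lemma lax_skew x : Sum N (fun j => fst (x j) * fst (mulv N lax x j) +
                                   snd (x j) * snd (mulv N lax x j)) = 0.
Proof.
  set (W := CSum N (fun j => CSum N (fun l =>
    Cmult (Cmult (Cconj (x j)) (lax_sym j l)) (x l)))).
  assert (HW : Cconj W = W).
  { unfold W. rewrite Cconj_CSum.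
    erewrite CSum_ext by (intros p _; rewrite Cconj_CSum; reflexivity).
    rewrite CSum_swap. apply CSum_ext; intros j _. apply CSum_ext; intros l _.
    rewrite !Cmult_conj, Cconj_conj, lax_sym_hermitian. ring. }
  assert (HR : forall n f, fst (CSum n f) = Sum n (fun i => fst (f i))).
  { induction n as [|n IH]; intros f; simpl; [reflexivity|now rewrite IH]. }
  transitivity (fst (Cmult (Copp Ci) W)).
  - unfold W. rewrite <- CSum_scal, HR. apply Sum_ext; intros j _.
    transitivity (fst (Cmult (Cconj (x j)) (mulv N lax x j))); [simpl; ring|].
    f_equal. unfold mulv. rewrite <- !CSum_scal. apply CSum_ext; intros l _.
    unfold lax. ring.
  - apply (f_equal snd) in HW. simpl in *. lra.
Qed.

Variable M : R.
Hypothesis HM : Sum N (fun n => Cmod (v n)) <= M.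

Lemma coef_le n : Cmod (v n) <= M.
Proof.
  destruct (le_lt_dec N n) as [H|H].
  - rewrite (Hv n H), Cmod_0. eapply Rle_trans; [|exact HM].
    apply Sum_nonneg; intros; apply Cmod_ge_0.
  - eapply Rle_trans; [|exact HM].
    apply (Sum_term N (fun n => Cmod (v n))); [intros; apply Cmod_ge_0|assumption].
Qed.

Lemma coef_bound_nonneg : 0 <= M.
Proof. eapply Rle_trans; [apply Cmod_ge_0|apply (coef_le N)]. Qed.

Lemma lax_entry_le j l : Cmod (lax j l) <= 2 * M ^ 2.
Proof.
  pose proof coef_bound_nonneg as HM0.
  unfold lax. rewrite Cmod_mult, Cmod_opp, Cmod_Ci, Rmult_1_l.
  unfold lax_sym, Cminus. eapply Rle_trans; [apply Cmod_triangle|].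
  rewrite Cmod_opp, Cmod_mult, Cmod_R, Rabs_pos_eq by lra.
  assert (H1 : Cmod (toeplitz j l) <= M * M).
  { unfold toeplitz. eapply Rle_trans; [apply Cmod_CSum|].
    apply Rle_trans with (Sum N (fun p => M * Cmod (v p))).
    - apply Sum_le; intros p _. eapply Rle_trans; [apply Cmod_CSum|].
      rewrite Rmult_comm.
      apply Rle_trans with (Cmod (v p) * Sum N (fun q => Cmod (v q))).
      + rewrite <- Sum_scal. apply Sum_le; intros q _. destruct (Nat.eqb _ _).
        * rewrite Cmod_mult, Cmod_conj. lra.
        * rewrite Cmod_0. apply Rmult_le_pos; apply Cmod_ge_0.
      + apply Rmult_le_compat_l; [apply Cmod_ge_0|assumption].
    - rewrite Sum_scal. apply Rmult_le_compat_l; assumption. }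
  assert (H2 : Cmod (hankel_sq j l) <= M * M).
  { unfold hankel_sq. eapply Rle_trans; [apply Cmod_CSum|].
    apply Rle_trans with (Sum N (fun a => M * Cmod (v (j + a)%nat))).
    - apply Sum_le; intros a _. rewrite Cmod_mult, Cmod_conj, Rmult_comm.
      apply Rmult_le_compat_r; [apply Cmod_ge_0|apply coef_le].
    - rewrite Sum_scal. apply Rmult_le_compat_l; [assumption|].
      apply Rle_trans with (Sum (j + N) (fun n => Cmod (v n))).
      + rewrite (Sum_shift N j). pose proof (Sum_nonneg j (fun n => Cmod (v n))
          (fun n _ => Cmod_ge_0 _)). lra.
      + rewrite Nat.add_comm, Sum_shift, (Sum_ext j _ (fun _ => 0)), Sum_zero; [lra|].
        intros i _. rewrite Hv by lia. apply Cmod_0. }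
  pose proof (pow2_ge_0 M). lra.
Qed.

Definition euler_mx (h : R) : mx := fun j l =>
  Cplus (if Nat.eqb j l then RtoC 1 else RtoC 0) (Cmult (RtoC h) (lax j l)).

Lemma CSum_kronecker j z : (j < N)%nat ->
  CSum N (fun l => Cmult (if Nat.eqb j l then RtoC 1 else RtoC 0) (z l)) = z j.
Proof.
  intros Hj. transitivity (CSum N (fun l => if Nat.eqb j (0 + l) then z l else RtoC 0)).
  - apply CSum_ext; intros l _. simpl. destruct (Nat.eqb j l); ring.
  - rewrite CSum_delta by assumption. simpl. now rewrite Nat.sub_0_r.
Qed.

Lemma euler_mx_mulv h x j : (j < N)%nat ->
  mulv N (euler_mx h) x j = Cplus (x j) (Cmult (RtoC h) (mulv N lax x j)).
Proof.
  intros Hj. unfold mulv. rewrite <- (CSum_kronecker j x Hj), <- CSum_scal, <- CSum_plus.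
  apply CSum_ext; intros l _. unfold euler_mx. ring.
Qed.

(** A crude bound from the size of the entries suffices: the factor [INR N] will only multiply h^2,
    with [N] fixed as h tends to 0. *)
Lemma lax_norm2_le x : norm2 N (mulv N lax x) <= (INR N * (2 * M ^ 2)) ^ 2 * norm2 N x.
Proof.
  assert (HN : 0 <= norm2 N x) by (apply (Sum_sqr_nonneg N (fun i => Cmod (x i)))).
  assert (Hrow : forall j, Cmod (mulv N lax x j) <= 2 * M ^ 2 * (sqrt (INR N) * sqrt (norm2 N x))).
  { intros j. unfold mulv. eapply Rle_trans; [apply Cmod_CSum|].
    apply Rle_trans with (2 * M ^ 2 * Sum N (fun l => 1 * Cmod (x l))).
    - rewrite <- Sum_scal. apply Sum_le; intros l _. rewrite Cmod_mult, Rmult_1_l.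
      apply Rmult_le_compat_r; [apply Cmod_ge_0|apply lax_entry_le].
    - apply Rmult_le_compat_l; [pose proof (pow2_ge_0 M); lra|].
      apply Sum_cauchy_schwarz; try apply sqrt_pos.
      + rewrite pow2_sqrt by apply pos_INR. rewrite Sum_const. right; ring.
      + rewrite pow2_sqrt by assumption. right; reflexivity. }
  unfold norm2 at 1.
  apply Rle_trans with (Sum N (fun _ => (2 * M ^ 2 * (sqrt (INR N) * sqrt (norm2 N x))) ^ 2)).
  - apply Sum_le; intros j _. apply pow_incr. split; [apply Cmod_ge_0|apply Hrow].
  - rewrite Sum_const, !(Rpow_mult_distr _ _ 2), !pow2_sqrt by (assumption || apply pos_INR).
    right; ring.
Qed.

(** The cross term 2h Re <x, Lx> vanishes by skew-adjointness, so I + hL is an isometry up to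
    O(h^2). *)
Lemma euler_mx_norm2 h x :
  norm2 N (mulv N (euler_mx h) x) <= (1 + h ^ 2 * (INR N * (2 * M ^ 2)) ^ 2) * norm2 N x.
Proof.
  apply Rle_trans with (norm2 N x + (2 * h) * 0 + h ^ 2 * norm2 N (mulv N lax x)).
  - rewrite <- (lax_skew x). unfold norm2. rewrite <- !Sum_scal, <- !Sum_plus.
    apply Sum_le; intros j Hj. rewrite euler_mx_mulv by assumption.
    generalize (mulv N lax x j) as y. intros y.
    rewrite !Cmod2_alt. unfold Re, Im. simpl. right; ring.
  - pose proof (lax_norm2_le x).
    apply (Rmult_le_compat_l (h ^ 2)) in H; [lra|apply pow2_ge_0].
Qed.

(** Expanding (I + hL) H (I + hL)^T leaves only h^2 L H L^T beyond the Lax increment. *)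
Lemma euler_mx_congr h j k : (j < N)%nat -> (k < N)%nat ->
  congr N (euler_mx h) (fun j k => v (j + k)%nat) j k =
  Cplus (Cplus (v (j + k)%nat) (Cmult (RtoC h) (Cmult (Copp Ci) (rect N N v (j + k)))))
        (Cmult (RtoC (h ^ 2)) (congr N lax (fun j k => v (j + k)%nat) j k)).
Proof.
  intros Hj Hk. rewrite lax_equation.
  assert (E1 : v (j + k)%nat = CSum N (fun l => CSum N (fun m =>
    Cmult (Cmult (if Nat.eqb j l then RtoC 1 else RtoC 0) (v (l + m)%nat))
      (if Nat.eqb k m then RtoC 1 else RtoC 0)))).
  { transitivity (CSum N (fun l =>
      Cmult (if Nat.eqb j l then RtoC 1 else RtoC 0) (v (l + k)%nat))).
    - symmetry. now apply (CSum_kronecker j (fun l => v (l + k)%nat)).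
    - apply CSum_ext; intros l _.
      rewrite <- (CSum_kronecker k (fun m => v (l + m)%nat) Hk), <- CSum_scal.
      apply CSum_ext; intros m _. ring. }
  assert (E2 : CSum N (fun l => Cmult (lax j l) (v (l + k)%nat)) =
    CSum N (fun l => CSum N (fun m => Cmult (Cmult (lax j l) (v (l + m)%nat))
      (if Nat.eqb k m then RtoC 1 else RtoC 0)))).
  { apply CSum_ext; intros l _.
    rewrite <- (CSum_kronecker k (fun m => v (l + m)%nat) Hk), <- CSum_scal.
    apply CSum_ext; intros m _. ring. }
  assert (E3 : CSum N (fun m => Cmult (v (j + m)%nat) (lax k m)) =
    CSum N (fun l => CSum N (fun m =>
      Cmult (Cmult (if Nat.eqb j l then RtoC 1 else RtoC 0) (v (l + m)%nat)) (lax k m)))).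
  { rewrite CSum_swap. apply CSum_ext; intros m _.
    rewrite <- (CSum_kronecker j (fun l => v (l + m)%nat) Hj), Cmult_comm, <- CSum_scal.
    apply CSum_ext; intros l _. ring. }
  rewrite E2, E3, E1. unfold congr.
  rewrite <- CSum_plus, <- !CSum_scal, <- !CSum_plus.
  apply CSum_ext; intros l _.
  rewrite <- CSum_plus, <- !CSum_scal, <- !CSum_plus.
  apply CSum_ext; intros m _. unfold euler_mx.
  replace (RtoC (h ^ 2)) with (Cmult (RtoC h) (RtoC h))
    by (apply injective_projections; simpl; ring).
  ring.
Qed.

Lemma congr_lax_entry_le j k :
  Cmod (congr N lax (fun j k => v (j + k)%nat) j k) <= INR N ^ 2 * ((2 * M ^ 2) ^ 2 * M).
Proof.
  unfold congr. eapply Rle_trans; [apply Cmod_CSum|].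
  apply Rle_trans with (Sum N (fun _ => INR N * ((2 * M ^ 2) ^ 2 * M))).
  - apply Sum_le; intros l _. eapply Rle_trans; [apply Cmod_CSum|].
    rewrite <- Sum_const. apply Sum_le; intros m _. rewrite !Cmod_mult.
    replace ((2 * M ^ 2) ^ 2 * M) with (2 * M ^ 2 * M * (2 * M ^ 2)) by ring.
    apply Rmult_le_compat; try apply lax_entry_le; try apply Cmod_ge_0.
    + apply Rmult_le_pos; apply Cmod_ge_0.
    + apply Rmult_le_compat; try apply Cmod_ge_0; [apply lax_entry_le|apply coef_le].
  - rewrite Sum_const. right; ring.
Qed.
End Lax.

(** * Wiener bound and global Gevrey regularity *)

Definition trunc (N : nat) (a : nat -> C) (n : nat) : C :=
  if Nat.ltb n N then a n else RtoC 0.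

Lemma trunc_vanish N a n : (N <= n)%nat -> trunc N a n = RtoC 0.
Proof. intros H. unfold trunc. destruct (Nat.ltb_spec n N); [lia|reflexivity]. Qed.

Lemma Cmod_trunc_le N a n : Cmod (trunc N a n) <= Cmod (a n).
Proof.
  unfold trunc. destruct (Nat.ltb n N); [lra|]. rewrite Cmod_0. apply Cmod_ge_0.
Qed.

Lemma Sum_indicator_le N n c : 0 <= c ->
  Sum N (fun j => if Nat.leb j n then c else 0) <= (1 + INR n) * c.
Proof.
  intros Hc. apply Rle_trans with (INR (min N (S n)) * c).
  - induction N as [|N IH]; [simpl; lra|]. cbn [Sum]. destruct (Nat.leb_spec N n).
    + rewrite Nat.min_l in * by lia. rewrite S_INR. lra.
    + rewrite Nat.min_r in * by lia. lra.
  - apply Rmult_le_compat_r; [assumption|]. rewrite Rplus_comm, <- S_INR. apply le_INR. lia.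
Qed.

(** A Hankel matrix repeats the value at n at most 1 + n times; hence its entrywise l^1 norm costs
    one power of the frequency. *)
Lemma Sum_antidiagonal N f : (forall n, 0 <= f n) ->
  Sum N (fun j => Sum N (fun k => f (j + k)%nat)) <= Sum (2 * N) (fun n => (1 + INR n) * f n).
Proof.
  intros Hf.
  apply Rle_trans with (Sum N (fun j => Sum N (fun k => Sum (2 * N) (fun n =>
    if Nat.eqb n (j + k) then f n else 0)))).
  - apply Sum_le; intros j Hj. apply Sum_le; intros k Hk.
    eapply Rle_trans; [|apply (Sum_term (2 * N) _ (j + k)); [|lia]].
    + cbv beta. rewrite Nat.eqb_refl. lra.
    + intros n. cbv beta. destruct (Nat.eqb _ _); [apply Hf|lra].
  - rewrite (Sum_ext N _ (fun j => Sum (2 * N) (fun n => Sum N (fun k =>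
      if Nat.eqb n (j + k) then f n else 0)))) by (intros; apply Sum_swap).
    rewrite Sum_swap. apply Sum_le; intros n _.
    eapply Rle_trans; [|apply (Sum_indicator_le N n (f n) (Hf n))].
    apply Sum_le; intros j _. destruct (Nat.leb_spec j n).
    + apply Sum_single_le; [apply Hf|]. intros k k'. rewrite !Nat.eqb_eq. lia.
    + rewrite (Sum_ext _ _ (fun _ => 0)), Sum_zero; [lra|].
      intros k _. destruct (Nat.eqb_spec n (j + k)); [lia|reflexivity].
Qed.

Lemma Sum_even_odd m f :
  Sum (2 * m) f = Sum m (fun k => f (k + (0 + k))%nat) + Sum m (fun k => f (k + (1 + k))%nat).
Proof.
  induction m as [|m IH]; [simpl; ring|].
  replace (2 * S m)%nat with (S (S (2 * m))) by lia. cbn [Sum]. rewrite IH.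
  replace (2 * m)%nat with (m + (0 + m))%nat by lia.
  replace (S (m + (0 + m))) with (m + (1 + m))%nat by lia. ring.
Qed.

Section LaxFlow.
Variables (u d : R -> nat -> C) (T A : R).
Hypothesis Hflow : flow u d.
Hypothesis HT : 0 <= T.
Hypothesis HA : forall t, 0 <= t <= T -> forall m,
  Sum m (fun n => (1 + INR n) ^ 2 * Cmod (u t n)) <= A.

Lemma weighted_nonneg t n : 0 <= (1 + INR n) ^ 2 * Cmod (u t n).
Proof. apply Rmult_le_pos; [apply pow2_ge_0|apply Cmod_ge_0]. Qed.

Lemma weighted_bound_nonneg : 0 <= A.
Proof. apply (HA 0 ltac:(lra) O). Qed.

Lemma wiener_le_weighted t : 0 <= t <= T -> forall m, Sum m (fun n => Cmod (u t n)) <= A.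
Proof.
  intros Ht m. eapply Rle_trans; [|apply (HA t Ht m)].
  apply Sum_le; intros n _. rewrite <- (Rmult_1_l (Cmod _)) at 1.
  apply Rmult_le_compat_r; [apply Cmod_ge_0|]. apply pow_R1_Rle.
  pose proof (pos_INR n). lra.
Qed.

(** One power of the weights of p and r pays for 1 + k <= (1+p)(1+r). The remaining
    (1+p)(1+r)(1+q)^2 is at least [N] whichever frequency is large, k included. *)
Lemma resonance_weight N k p q r : (1 <= N)%nat -> (k + q = p + r)%nat ->
  (N <= p)%nat \/ (N <= q)%nat \/ (N <= r)%nat \/ (N <= k)%nat ->
  1 + INR k <= / INR N * ((1 + INR p) ^ 2 * ((1 + INR q) ^ 2 * (1 + INR r) ^ 2)).
Proof.
  intros HN E H.
  assert (HN0 : 0 < INR N) by (apply lt_0_INR; lia).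
  apply Rmult_le_reg_l with (INR N); [assumption|].
  rewrite <- (Rmult_assoc (INR N)), Rinv_r, Rmult_1_l by lra.
  pose proof (pos_INR p) as Hp. pose proof (pos_INR q) as Hq. pose proof (pos_INR r) as Hr.
  assert (Hk : 1 + INR k <= (1 + INR p) * (1 + INR r)).
  { assert (INR k <= INR p + INR r) by (rewrite <- plus_INR; apply le_INR; lia).
    assert (0 <= INR p * INR r) by (apply Rmult_le_pos; assumption). lra. }
  set (a := 1 + INR p) in *. set (c := 1 + INR q) in *. set (e := 1 + INR r) in *.
  assert (Ha : 1 <= a) by (unfold a; lra). assert (Hc : 1 <= c) by (unfold c; lra).
  assert (He : 1 <= e) by (unfold e; lra).
  assert (Hae : 1 <= a * e) by (rewrite <- (Rmult_1_l 1); apply Rmult_le_compat; lra).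
  assert (HNle : INR N <= a * e * c ^ 2).
  { assert (Hc2 : c <= c ^ 2) by (simpl; rewrite Rmult_1_r; rewrite <- (Rmult_1_l c) at 1;
      apply Rmult_le_compat_r; lra).
    assert (Hx : forall y, y <= a * e -> y <= a * e * c ^ 2).
    { intros y Hy. eapply Rle_trans; [exact Hy|].
      rewrite <- (Rmult_1_r (a * e)) at 1. apply Rmult_le_compat_l; lra. }
    destruct H as [H|[H|[H|H]]]; apply le_INR in H.
    - apply Hx. apply Rle_trans with (a * 1); [unfold a; lra|]. apply Rmult_le_compat_l; lra.
    - apply Rle_trans with (1 * c); [unfold c; lra|]. apply Rmult_le_compat; lra.
    - apply Hx. apply Rle_trans with (1 * e); [unfold e; lra|]. apply Rmult_le_compat_r; lra.
    - apply Hx. lra. }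
  apply Rle_trans with (a * e * c ^ 2 * (a * e)).
  - apply Rmult_le_compat; [lra| |assumption|assumption]. pose proof (pos_INR k). lra.
  - right; ring.
Qed.

Lemma Q4_weighted_le t N J : 0 <= t <= T -> (1 <= N)%nat ->
  Q4 J (fun _ p q r => / INR N *
    ((1 + INR p) ^ 2 * Cmod (u t p) *
     ((1 + INR q) ^ 2 * Cmod (u t q) * ((1 + INR r) ^ 2 * Cmod (u t r))))) <= A ^ 3 / INR N.
Proof.
  intros Ht HN. rewrite Q4_scal.
  replace (A ^ 3 / INR N) with (/ INR N * (A * (A * A))) by (unfold Rdiv; ring).
  apply Rmult_le_compat_l; [left; apply Rinv_0_lt_compat, lt_0_INR; lia|].
  apply (Q4_omit_k J (fun p => (1 + INR p) ^ 2 * Cmod (u t p))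
    (fun p => (1 + INR p) ^ 2 * Cmod (u t p)) (fun p => (1 + INR p) ^ 2 * Cmod (u t p)));
    auto using weighted_nonneg.
Qed.

(** Truncation fails the equation in two ways: below [N] the cubic term misses interactions with
    high modes (weight [c1]), and from [N] on the truncated cubic term still has output while the
    truncated state has none (weight [c2]). Each costs A^3 / N. *)
Lemma lax_defect_le t N : 0 <= t <= T -> (1 <= N)%nat ->
  Sum N (fun j => Sum N (fun k => Cmod
    (Cplus (trunc N (d t) (j + k)) (Cmult Ci (rect N N (trunc N (u t)) (j + k)))))) <=
  2 * (A ^ 3 / INR N).
Proof.
  intros Ht HN. set (v := trunc N (u t)).
  assert (Hv : forall n, (N <= n)%nat -> v n = RtoC 0) by (intros; now apply trunc_vanish).
  assert (Hvle : forall n, Cmod (v n) <= Cmod (u t n)) by (intros; apply Cmod_trunc_le).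
  eapply Rle_trans; [apply (Sum_antidiagonal N (fun n => Cmod
    (Cplus (trunc N (d t) n) (Cmult Ci (rect N N v n))))); intros; apply Cmod_ge_0|].
  set (c1 := fun n => if Nat.ltb n N then 1 + INR n else 0).
  set (c2 := fun n => if Nat.ltb n N then 0 else 1 + INR n).
  assert (Hc1 : forall n, 0 <= c1 n)
    by (intros n; unfold c1; pose proof (INR1_pos n); destruct (Nat.ltb n N); lra).
  assert (Hc2 : forall n, 0 <= c2 n)
    by (intros n; unfold c2; pose proof (INR1_pos n); destruct (Nat.ltb n N); lra).
  destruct Hflow as (_ & _ & H3).
  assert (HxN : forall p q r, 0 <= Cmod (u t p) * (Cmod (u t q) * Cmod (u t r)))
    by (intros; repeat apply Rmult_le_pos; apply Cmod_ge_0).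
  assert (B1 : Sum (2 * N) (fun n => c1 n * Cmod (Cminus (Cmult Ci (d t n)) (rect N N v n))) <=
               A ^ 3 / INR N).
  { apply (cubic_compare (u t) v (fun n => Cmult Ci (d t n)) (fun n => rect N N v n) c1
      (fun p q r => if (Nat.ltb p N && Nat.ltb q N && Nat.ltb r N)%bool then 0
                    else Cmod (u t p) * (Cmod (u t q) * Cmod (u t r)))).
    - exact Hc1.
    - intros k _. apply H3.
    - intros k _. now apply rect_series.
    - intros p q r. unfold cubic, v, trunc.
      destruct (Nat.ltb p N), (Nat.ltb q N), (Nat.ltb r N); simpl andb; cbv iota;
        try (replace (Cminus _ _) with (RtoC 0) by ring; rewrite Cmod_0; lra);
        rewrite <- Cmod_cubic; unfold cubic; right; f_equal;
        apply injective_projections; simpl; ring.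
    - intros J. eapply Rle_trans; [|apply (Q4_weighted_le t N J Ht HN)].
      apply Q4_le. intros k p q r E.
      destruct (Nat.ltb_spec p N), (Nat.ltb_spec q N), (Nat.ltb_spec r N); simpl andb; cbv iota.
      1: { rewrite Rmult_0_r. apply Rmult_le_pos; [left; apply Rinv_0_lt_compat, lt_0_INR; lia|].
           apply Rmult_le_pos; [apply weighted_nonneg|apply Rmult_le_pos; apply weighted_nonneg]. }
      all: apply Rle_trans with ((1 + INR k) * (Cmod (u t p) * (Cmod (u t q) * Cmod (u t r))));
        [apply Rmult_le_compat_r; [apply HxN|unfold c1; pose proof (INR1_pos k);
          destruct (Nat.ltb k N); lra]
        |eapply Rle_trans;
          [apply Rmult_le_compat_r; [apply HxN|apply (resonance_weight N k p q r HN E); tauto]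
          |right; ring]]. }
  assert (B2 : Sum (2 * N) (fun n => c2 n * Cmod (Cminus (rect N N v n) (RtoC 0))) <=
               A ^ 3 / INR N).
  { apply (cubic_compare v (fun _ => RtoC 0) (fun n => rect N N v n) (fun _ => RtoC 0) c2
      (fun p q r => Cmod (u t p) * (Cmod (u t q) * Cmod (u t r)))).
    - exact Hc2.
    - intros k _. now apply rect_series.
    - intros k _. apply szego_zero.
    - intros p q r. replace (Cminus _ _) with (cubic v p q r) by (unfold cubic; ring).
      rewrite Cmod_cubic.
      apply Rmult_le_compat; auto using Cmod_ge_0, Rmult_le_pos.
      apply Rmult_le_compat; auto using Cmod_ge_0.
    - intros J. eapply Rle_trans; [|apply (Q4_weighted_le t N J Ht HN)].
      apply Q4_le. intros k p q r E. unfold c2. destruct (Nat.ltb_spec k N).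
      + rewrite Rmult_0_l. apply Rmult_le_pos; [left; apply Rinv_0_lt_compat, lt_0_INR; lia|].
        apply Rmult_le_pos; [apply weighted_nonneg|apply Rmult_le_pos; apply weighted_nonneg].
      + eapply Rle_trans;
          [apply Rmult_le_compat_r; [apply HxN|apply (resonance_weight N k p q r HN E); tauto]|].
        right; ring. }
  apply Rle_trans with (Sum (2 * N) (fun n =>
    c1 n * Cmod (Cminus (Cmult Ci (d t n)) (rect N N v n)) +
    c2 n * Cmod (Cminus (rect N N v n) (RtoC 0)))); [|rewrite Sum_plus; lra].
  apply Sum_le; intros n _. unfold c1, c2, trunc. destruct (Nat.ltb n N).
  - rewrite Rmult_0_l, Rplus_0_r. right. f_equal.
    replace (Cminus (Cmult Ci (d t n)) (rect N N v n)) with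
      (Cmult Ci (Cplus (d t n) (Cmult Ci (rect N N v n))))
      by (apply injective_projections; simpl; ring).
    rewrite Cmod_mult, Cmod_Ci. ring.
  - rewrite Rmult_0_l, Rplus_0_l. right. f_equal.
    replace (Cplus (RtoC 0) (Cmult Ci (rect N N v n))) with
      (Cmult Ci (Cminus (rect N N v n) (RtoC 0))) by ring.
    rewrite Cmod_mult, Cmod_Ci. ring.
Qed.

Definition hankel (N : nat) (t : R) : mx := fun j k => trunc N (u t) (j + k)%nat.

Lemma Sum_trunc_le N t : 0 <= t <= T -> Sum N (fun n => Cmod (trunc N (u t) n)) <= A.
Proof.
  intros Ht. eapply Rle_trans; [|apply (wiener_le_weighted t Ht N)].
  apply Sum_le; intros n _. apply Cmod_trunc_le.
Qed.

(** The Lax congruence multiplies the trace norm by 1 + O(h^2), and everything else is an entrywise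
    small perturbation. After refining the step only the rate 2 A^3 / N survives, and it vanishes as
    [N] grows. *)
Lemma nuc_step N t h c : (1 <= N)%nat -> 0 <= t -> 0 <= h -> t + h <= T ->
  nuc N (hankel N t) c ->
  nuc N (hankel N (t + h))
    ((1 + h ^ 2 * (INR N * (2 * A ^ 2)) ^ 2) * c + 2 * (A ^ 3 / INR N) * h +
     (INR N ^ 4 * ((2 * A ^ 2) ^ 2 * A) + INR N ^ 2 * (3 * A ^ 5)) * h ^ 2).
Proof.
  intros HN Ht Hh HtT Hnuc.
  assert (Ht' : 0 <= t <= T) by lra.
  set (v := trunc N (u t)).
  assert (Hv : forall n, (N <= n)%nat -> v n = RtoC 0) by (intros; now apply trunc_vanish).
  pose proof (Sum_trunc_le N t Ht') as HvA. fold v in HvA.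
  set (g := sqrt (1 + h ^ 2 * (INR N * (2 * A ^ 2)) ^ 2)).
  assert (Hg : g ^ 2 = 1 + h ^ 2 * (INR N * (2 * A ^ 2)) ^ 2).
  { apply pow2_sqrt. assert (0 <= h ^ 2 * (INR N * (2 * A ^ 2)) ^ 2)
      by (apply Rmult_le_pos; apply pow2_ge_0). lra. }
  set (G := euler_mx N v h).
  assert (HG : nuc N (congr N G (hankel N t)) (g ^ 2 * c)).
  { apply nuc_congr; [apply sqrt_pos| |assumption].
    intros x. rewrite Hg. now apply euler_mx_norm2. }
  set (E := fun j k : nat => Cminus (hankel N (t + h) j k) (congr N G (hankel N t) j k)).
  assert (HE : Sum N (fun j => Sum N (fun k => Cmod (E j k))) <=
    2 * (A ^ 3 / INR N) * h +
     (INR N ^ 4 * ((2 * A ^ 2) ^ 2 * A) + INR N ^ 2 * (3 * A ^ 5)) * h ^ 2).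
  { set (D := fun j k => Cmod (Cplus (trunc N (d t) (j + k)) (Cmult Ci (rect N N v (j + k))))).
    apply Rle_trans with (Sum N (fun j => Sum N (fun k => h * D j k +
      (h ^ 2 * (INR N ^ 2 * ((2 * A ^ 2) ^ 2 * A)) + 3 * A ^ 5 * h ^ 2)))).
    - apply Sum_le; intros j Hj. apply Sum_le; intros k Hk.
      set (rem := trunc N (fun n => Cminus (u (t + h) n) (Cplus (u t n) (Cmult (RtoC h) (d t n))))).
      assert (EE : E j k = Cplus (Cmult (RtoC h)
          (Cplus (trunc N (d t) (j + k)) (Cmult Ci (rect N N v (j + k)))))
        (Cplus (Copp (Cmult (RtoC (h ^ 2)) (congr N (lax N v) (fun j k => v (j + k)%nat) j k)))
          (rem (j + k)%nat))).
      { unfold E. unfold G at 1.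
        change (congr N (euler_mx N v h) (hankel N t) j k) with
          (congr N (euler_mx N v h) (fun j k => v (j + k)%nat) j k).
        rewrite (euler_mx_congr N v Hv) by assumption.
        unfold hankel, rem, v, trunc. destruct (Nat.ltb (j + k) N); ring. }
      rewrite EE. eapply Rle_trans; [apply Cmod_triangle|]. apply Rplus_le_compat.
      + rewrite Cmod_mult, Cmod_R, Rabs_pos_eq by assumption. right; reflexivity.
      + eapply Rle_trans; [apply Cmod_triangle|]. apply Rplus_le_compat.
        * rewrite Cmod_opp, Cmod_mult, Cmod_R, Rabs_pos_eq by apply pow2_ge_0.
          apply Rmult_le_compat_l; [apply pow2_ge_0|]. now apply congr_lax_entry_le.
        * pose proof weighted_bound_nonneg. unfold rem, trunc. destruct (Nat.ltb_spec (j + k) N).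
          -- eapply Rle_trans;
               [|apply (flow_taylor u d Hflow T A wiener_le_weighted t h N Ht Hh HtT)].
             apply (Sum_term N (fun n => Cmod (Cminus (u (t + h) n)
               (Cplus (u t n) (Cmult (RtoC h) (d t n)))))); [intros; apply Cmod_ge_0|assumption].
          -- rewrite Cmod_0. apply Rmult_le_pos; [|apply pow2_ge_0].
             apply Rmult_le_pos; [lra|now apply pow_le].
    - erewrite Sum_ext by (intros j _; rewrite Sum_plus, Sum_scal, Sum_const; reflexivity).
      rewrite Sum_plus, Sum_scal, Sum_const.
      pose proof (lax_defect_le t N Ht' HN) as HD. fold v in HD.
      apply (Rmult_le_compat_l h) in HD; [|assumption].
      unfold D. lra. }
  apply nuc_le with (g ^ 2 * c + Sum N (fun j => Sum N (fun k => Cmod (E j k)))).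
  - apply (nuc_ext _ _ _ _ (nuc_perturb N _ E _ HG)).
    intros j k _ _. unfold E. ring.
  - rewrite Hg. lra.
Qed.

(* Conservation of the trace norm of the Hankel operator; the diagonals
   [u_{2k}] and [u_{2k+1}] then bound the Wiener norm. *)
Lemma wiener_bound C0 m :
  (forall k, Cmod (u 0 k) * (1 + INR k) ^ 4 <= C0) ->
  Sum m (fun k => Cmod (u T k)) <= 8 * C0.
Proof.
  intros HC0.
  assert (HC : 0 <= C0).
  { eapply Rle_trans; [|apply (HC0 O)].
    apply Rmult_le_pos; [apply Cmod_ge_0|apply pow_le; left; apply INR1_pos]. }
  pose proof weighted_bound_nonneg as HA0.
  apply le_epsilon. intros eps Heps.
  assert (HA3 : 0 <= A ^ 3) by now apply pow_le.
  assert (Hz : 0 <= 2 * A ^ 3 * T * 4 / eps).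
  { apply Rmult_le_pos; [|left; now apply Rinv_0_lt_compat].
    apply Rmult_le_pos; [|lra]. apply Rmult_le_pos; lra. }
  destruct (INR_unbounded (2 * A ^ 3 * T * 4 / eps)) as [N0 HN0].
  (* Large enough to keep the accumulated defect below eps/4 and to contain the indices up to 2m - 1
     on the two diagonals. *)
  set (N := (N0 + 2 * m + 1)%nat).
  assert (HNpos : 0 < INR N) by (apply lt_0_INR; unfold N; lia).
  assert (HNeps : 2 * (A ^ 3 / INR N) * T <= eps / 4).
  { assert (HNN : 2 * A ^ 3 * T * 4 / eps <= INR N)
      by (eapply Rle_trans; [left; exact HN0|apply le_INR; unfold N; lia]).
    apply Rmult_le_reg_r with (INR N * 4 / eps); [apply Rdiv_lt_0_compat; lra|].
    replace (2 * (A ^ 3 / INR N) * T * (INR N * 4 / eps)) with (2 * A ^ 3 * T * 4 / eps)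
      by (field; lra).
    replace (eps / 4 * (INR N * 4 / eps)) with (INR N) by (field; lra). exact HNN. }
  assert (Hrho : 0 <= 2 * (A ^ 3 / INR N)).
  { apply Rmult_le_pos; [lra|]. apply Rmult_le_pos; [assumption|].
    left; now apply Rinv_0_lt_compat. }
  set (B1 := (INR N * (2 * A ^ 2)) ^ 2).
  set (B2 := INR N ^ 4 * ((2 * A ^ 2) ^ 2 * A) + INR N ^ 2 * (3 * A ^ 5)).
  assert (HB1 : 0 <= B1) by apply pow2_ge_0.
  assert (HB2 : 0 <= B2).
  { unfold B2. apply Rplus_le_le_0_compat.
    - apply Rmult_le_pos; [apply pow_le; lra|]. apply Rmult_le_pos; [apply pow2_ge_0|assumption].
    - apply Rmult_le_pos; [apply pow2_ge_0|]. apply Rmult_le_pos; [lra|now apply pow_le]. }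
  (* At time 0, (1+j+k)^{-4} <= (1+j)^{-2} (1+k)^{-2}, and each inverse-square sum is at most 2. Two
     diagonals then give 8 C0. *)
  set (c0 := 4 * C0).
  destruct (euler_bound (fun t c => nuc N (hankel N t) c) T c0 (2 * (A ^ 3 / INR N))
    (B1 * (c0 + 2 * (A ^ 3 / INR N) * T + 1) + B2)) with (eps := eps / 4)
    as (e & He & Hnuc); try assumption; try lra.
  - apply Rplus_le_le_0_compat; [|assumption]. apply Rmult_le_pos; [assumption|].
    assert (0 <= 2 * (A ^ 3 / INR N) * T) by now apply Rmult_le_pos. unfold c0. lra.
  - intros t h e Ht Hh HtT He Hnuc.
    eapply nuc_le; [apply (nuc_step N t h e); try assumption; unfold N; lia|].
    fold B1 B2.
    assert (B1 * e <= B1 * (c0 + 2 * (A ^ 3 / INR N) * T + 1))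
      by now apply Rmult_le_compat_l.
    apply (Rmult_le_compat_l (h ^ 2)) in H; [|apply pow2_ge_0]. lra.
  - eapply nuc_le.
    + eapply nuc_ext; [apply (nuc_perturb N (fun _ _ => RtoC 0) (hankel N 0) 0);
        apply nuc_zero; [reflexivity|lra]|].
      intros j k _ _. cbv beta. ring.
    + rewrite Rplus_0_l.
      apply Rle_trans with (Sum N (fun j => C0 * Sum N inv2 * inv2 j)).
      * apply Sum_le; intros j _.
        replace (C0 * Sum N inv2 * inv2 j) with ((C0 * inv2 j) * Sum N inv2) by ring.
        rewrite <- Sum_scal. apply Sum_le; intros k _.
        eapply Rle_trans; [apply Cmod_trunc_le|].
        pose proof (INR1_pos j). pose proof (INR1_pos k).
        apply Rmult_le_reg_r with ((1 + INR j) ^ 2 * (1 + INR k) ^ 2);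
          [apply Rmult_lt_0_compat; apply pow_lt; assumption|].
        replace (C0 * inv2 j * inv2 k * ((1 + INR j) ^ 2 * (1 + INR k) ^ 2)) with C0
          by (unfold inv2; field; lra).
        eapply Rle_trans; [|apply (HC0 (j + k)%nat)].
        apply Rmult_le_compat_l; [apply Cmod_ge_0|].
        replace ((1 + INR (j + k)) ^ 4) with ((1 + INR (j + k)) ^ 2 * (1 + INR (j + k)) ^ 2) by ring.
        rewrite plus_INR. pose proof (pos_INR j). pose proof (pos_INR k).
        apply Rmult_le_compat; try apply pow2_ge_0; apply pow_incr; lra.
      * rewrite Sum_scal. pose proof (Sum_inv2 N).
        assert (0 <= Sum N inv2) by (apply Sum_nonneg; intros; left; apply inv2_pos).
        assert (C0 * Sum N inv2 <= C0 * 2) by now apply Rmult_le_compat_l.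
        apply Rle_trans with (C0 * 2 * 2); [|unfold c0; lra].
        apply Rmult_le_compat; try assumption. now apply Rmult_le_pos.
  - pose proof (nuc_diagonal N _ e 0 m Hnuc ltac:(unfold N; lia)) as D0.
    pose proof (nuc_diagonal N _ e 1 m Hnuc ltac:(unfold N; lia)) as D1.
    apply Rle_trans with (Sum (2 * m) (fun k => Cmod (u T k)));
      [apply Sum_le_size; [lia|intros; apply Cmod_ge_0]|].
    rewrite Sum_even_odd.
    assert (Htr : forall k s, (k < m)%nat -> (s <= 1)%nat ->
      hankel N T k (s + k)%nat = u T (k + (s + k))%nat).
    { intros k s Hk Hs. unfold hankel, trunc.
      destruct (Nat.ltb_spec (k + (s + k)) N); [reflexivity|unfold N in *; lia]. }
    rewrite (Sum_ext m _ (fun k => Cmod (u T (k + (0 + k))%nat))) in D0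
      by (intros k Hk; now rewrite Htr by lia).
    rewrite (Sum_ext m _ (fun k => Cmod (u T (k + (1 + k))%nat))) in D1
      by (intros k Hk; now rewrite Htr by lia).
    unfold c0 in He. lra.
Qed.
End LaxFlow.

(** * From local to global Gevrey regularity *)

Definition gevrey_le (s G : R) (a : nat -> C) : Prop :=
  forall m, Sum m (fun k => exp (s * INR k) * Cmod (a k)) <= G.

Lemma gevrey_le_mono s s' G G' a : s' <= s -> G <= G' -> gevrey_le s G a -> gevrey_le s' G' a.
Proof.
  intros Hs HG H m. eapply Rle_trans; [|exact HG]. eapply Rle_trans; [|apply (H m)].
  apply Sum_le; intros k _. apply Rmult_le_compat_r; [apply Cmod_ge_0|].
  apply exp_le, Rmult_le_compat_r; [apply pos_INR|assumption].
Qed.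

Lemma gevrey_decay s G : 0 < s -> exists C0, forall a, gevrey_le s G a ->
  forall k, Cmod (a k) * (1 + INR k) ^ 4 <= C0.
Proof.
  (* Chosen so that r (1 + k) <= 1 + s k / 4 <= exp(s k / 4); the fourth power is then absorbed by
     the weight. *)
  intros Hs. set (r := Rmin 1 (s / 4)).
  assert (Hr : 0 < r) by (apply Rmin_glb_lt; lra).
  assert (Hr1 : r <= 1) by apply Rmin_l. assert (Hrs : r <= s / 4) by apply Rmin_r.
  exists (G / r ^ 4). intros a HG k.
  apply Rmult_le_reg_r with (r ^ 4); [now apply pow_lt|].
  replace (G / r ^ 4 * r ^ 4) with G by (field; lra).
  eapply Rle_trans; [|apply (HG (S k))].
  eapply Rle_trans; [|apply (Sum_term (S k) (fun k => exp (s * INR k) * Cmod (a k)) k); [|lia]].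
  - rewrite Rmult_assoc, (Rmult_comm _ (Cmod (a k))).
    apply Rmult_le_compat_l; [apply Cmod_ge_0|].
    rewrite <- Rpow_mult_distr.
    replace (s * INR k) with (s / 4 * INR k + s / 4 * INR k + (s / 4 * INR k + s / 4 * INR k))
      by field.
    rewrite !exp_plus.
    replace (exp (s / 4 * INR k) * exp (s / 4 * INR k) * (exp (s / 4 * INR k) * exp (s / 4 * INR k)))
      with (exp (s / 4 * INR k) ^ 4) by ring.
    pose proof (pos_INR k). pose proof (INR1_pos k).
    apply pow_incr. split; [apply Rmult_le_pos; lra|].
    eapply Rle_trans; [|apply exp_ineq1_le].
    assert (r * INR k <= s / 4 * INR k) by (apply Rmult_le_compat_r; assumption). lra.
  - intros j. apply Rmult_le_pos; [left; apply exp_pos|apply Cmod_ge_0].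
Qed.

Lemma gevrey_le_excess s G a : 0 <= s -> gevrey_le s G a ->
  forall n, Sum n (fun k => (exp (s * INR k) - 1) * Cmod (a k)) <= G.
Proof.
  intros Hs H n. eapply Rle_trans; [|apply (H n)].
  apply Sum_le; intros k _. pose proof (Cmod_ge_0 (a k)). lra.
Qed.

Lemma gevrey_le_of_excess s e M a :
  (forall n, Sum n (fun k => (exp (s * INR k) - 1) * Cmod (a k)) <= e) ->
  (forall n, Sum n (fun k => Cmod (a k)) <= M) -> gevrey_le s (e + M) a.
Proof.
  intros He HM n. specialize (He n). specialize (HM n).
  rewrite (Sum_ext _ _ (fun k => (exp (s * INR k) - 1) * Cmod (a k) + Cmod (a k)))
    by (intros; ring).
  rewrite Sum_plus. lra.
Qed.

Lemma short_time_gevrey u d T b s G : flow u d -> 0 <= T -> 1 <= b -> T * (768 * b) <= 1 ->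
  (forall t, 0 <= t <= T -> H12_le (u t) b) -> 0 < s -> gevrey_le s G (u 0) ->
  exists s' G', 0 < s' /\ forall t, 0 <= t <= T -> gevrey_le s' G' (u t).
Proof.
  intros Hflow HT Hb HTb HH Hs HG.
  destruct (gevrey_decay s G Hs) as [C0 HC0].
  destruct (short_time_decay u d T b Hflow HT Hb HH C0 HTb (HC0 _ HG)) as [C1 HC1].
  assert (HC1p : 0 <= C1).
  { pose proof (HC1 0 ltac:(lra) O) as H. pose proof (Cmod_ge_0 (u 0 O)).
    unfold inv2 in H. simpl in H. lra. }
  set (M := 2 * C1).
  assert (HM : forall t, 0 <= t <= T -> forall n, Sum n (fun k => Cmod (u t k)) <= M).
  { intros t Ht n. apply Rle_trans with (C1 * Sum n inv2).
    - rewrite <- Sum_scal. apply Sum_le; intros k _. now apply HC1.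
    - unfold M. rewrite (Rmult_comm 2). apply Rmult_le_compat_l; [assumption|apply Sum_inv2]. }
  assert (HG0 : 0 <= G) by apply (HG O).
  set (l := 2 * (M * (M + (G + 1)))).
  assert (Hl : 0 <= l).
  { unfold l. apply Rmult_le_pos; [lra|]. apply Rmult_le_pos; unfold M; lra. }
  exists (s * exp (- (l * T))), (G + M). split.
  - apply Rmult_lt_0_compat; [assumption|apply exp_pos].
  - intros t Ht. apply gevrey_le_mono with (s * exp (- (l * t))) (G + M).
    + apply Rmult_le_compat_l; [lra|]. apply exp_le.
      assert (l * t <= l * T) by (apply Rmult_le_compat_l; lra). lra.
    + lra.
    + apply gevrey_le_of_excess; [|now apply HM]. intros n.
      apply (gevrey_propagation u d T M Hflow HM); try lra.
      * unfold l. lra.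
      * apply gevrey_le_excess; [lra|assumption].
Qed.

(** Continuation argument. The length of a restart depends only on the H^{1/2} bound near the
    supremum S of good times, not on the radius or Gevrey norm, which may deteriorate towards S; so
    a restart close enough to S passes beyond it. *)
Lemma gevrey_on_compacts u d s G T : flow u d -> 0 < s -> gevrey_le s G (u 0) -> 0 <= T ->
  exists s' G', 0 < s' /\ forall t, 0 <= t <= T -> gevrey_le s' G' (u t).
Proof.
  intros Hflow Hs HG HT.
  set (good := fun T => 0 <= T /\ exists s' G', 0 < s' /\
    forall t, 0 <= t <= T -> gevrey_le s' G' (u t)).
  apply NNPP. intros Hbad.
  assert (Hle : forall T', good T' -> T' <= T).
  { intros T' (HT' & s' & G' & Hs' & Hg). apply Rnot_lt_le. intros Hlt. apply Hbad.
    exists s', G'. split; [assumption|]. intros t Ht. apply Hg. lra. }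
  assert (H0 : good 0).
  { split; [lra|]. exists s, G. split; [assumption|].
    intros t Ht. now replace t with 0 by lra. }
  destruct (completeness good) as [S [HS1 HS2]].
  { exists T. exact Hle. }
  { now exists 0. }
  destruct Hflow as (H1 & Hflow'). pose proof (conj H1 Hflow' : flow u d) as Hflow.
  destruct (H1 S) as (e & b0 & He & Hb0).
  set (b := Rmax 1 b0).
  assert (Hb1 : 1 <= b) by apply Rmax_l.
  set (dl := Rmin (e / 2) (/ (768 * b))).
  assert (Hdl : 0 < dl) by (apply Rmin_glb_lt; [lra|apply Rinv_0_lt_compat; lra]).
  assert (Hdl1 : dl <= e / 2) by apply Rmin_l.
  assert (Hdl2 : dl * (768 * b) <= 1).
  { apply Rle_trans with (/ (768 * b) * (768 * b)).
    - apply Rmult_le_compat_r; [lra|apply Rmin_r].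
    - right; field; lra. }
  assert (Hex : exists T1, good T1 /\ S - dl / 2 < T1).
  { apply NNPP. intros Hn. assert (S <= S - dl / 2); [|lra].
    apply HS2. intros T1 HT1. apply Rnot_lt_le. intros Hlt. apply Hn. now exists T1. }
  destruct Hex as (T1 & HT1 & HST1). pose proof (HS1 T1 HT1) as HT1S.
  destruct HT1 as (HT1 & s1 & G1 & Hs1 & Hg1).
  destruct (short_time_gevrey (fun t => u (T1 + t)) (fun t => d (T1 + t)) dl b s1 G1)
    as (s2 & G2 & Hs2 & Hg2); try assumption; try lra.
  - now apply flow_shift.
  - intros t Ht m. eapply Rle_trans; [apply (Hb0 (T1 + t))|apply Rmax_r].
    apply Rabs_def1; lra.
  - rewrite Rplus_0_r. apply Hg1. lra.
  - assert (good (T1 + dl)).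
    { split; [lra|]. exists (Rmin s1 s2), (Rmax G1 G2). split; [now apply Rmin_glb_lt|].
      intros t Ht. destruct (Rle_lt_dec t T1) as [Hc|Hc].
      - apply gevrey_le_mono with s1 G1; [apply Rmin_l|apply Rmax_l|]. apply Hg1; lra.
      - apply gevrey_le_mono with s2 G2; [apply Rmin_r|apply Rmax_r|].
        replace t with (T1 + (t - T1)) by ring. apply Hg2; lra. }
    pose proof (HS1 _ H). lra.
Qed.

(** The constants are chosen before the flow, so the same pair will serve the solution and its time
    reflection. *)
Lemma gevrey_forward s G : 0 < s -> exists l C1, 0 < l /\ 0 < C1 /\
  forall u d, flow u d -> gevrey_le s G (u 0) ->
  forall t, 0 <= t -> gevrey_le (s * exp (- (l * t))) C1 (u t).
Proof.
  intros Hs. destruct (gevrey_decay s G Hs) as [C0 HC0].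
  set (M := Rmax 0 (8 * C0)). assert (HM0 : 0 <= M) by apply Rmax_l.
  set (G' := Rmax 0 G). assert (HG0 : 0 <= G') by apply Rmax_l.
  assert (HMG : 0 <= M * (M + (G' + 1))) by (apply Rmult_le_pos; lra).
  exists (2 * (M * (M + (G' + 1))) + 1), (G' + M + 1).
  split; [lra|]. split; [lra|]. intros u d Hflow HG t Ht.
  assert (HM : forall r, 0 <= r <= t -> forall n, Sum n (fun k => Cmod (u r k)) <= M).
  (* Regularity on [0,r] supplies a weighted bound that may depend on r; [wiener_bound] uses it
     qualitatively and returns a bound in terms of the initial decay alone. *)
  { intros r Hr n. destruct (gevrey_on_compacts u d s G r Hflow Hs HG ltac:(lra))
      as (s' & G1 & Hs' & Hg').
    destruct (gevrey_decay s' G1 Hs') as [C1 HC1].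
    eapply Rle_trans; [|apply Rmax_r].
    apply (wiener_bound u d r (C1 * 2) Hflow ltac:(lra)); [|intros k; now apply HC0].
    intros q Hq m. assert (HC1p : 0 <= C1).
    { eapply Rle_trans; [|apply (HC1 _ (Hg' q Hq) O)].
      apply Rmult_le_pos; [apply Cmod_ge_0|apply pow_le; left; apply INR1_pos]. }
    apply Rle_trans with (C1 * Sum m inv2).
    - rewrite <- Sum_scal. apply Sum_le; intros k _. pose proof (INR1_pos k).
      apply Rmult_le_reg_r with ((1 + INR k) ^ 2); [now apply pow_lt|].
      replace (C1 * inv2 k * (1 + INR k) ^ 2) with C1 by (unfold inv2; field; lra).
      eapply Rle_trans; [|apply (HC1 _ (Hg' q Hq) k)]. right; ring.
    - apply Rmult_le_compat_l; [assumption|apply Sum_inv2]. }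
  apply gevrey_le_mono with (s * exp (- ((2 * (M * (M + (G' + 1))) + 1) * t))) (G' + M); [lra|lra|].
  apply gevrey_le_of_excess; [|apply HM; lra]. intros n.
  apply (gevrey_propagation u d t M Hflow HM); try lra.
  intros j. eapply Rle_trans; [|apply Rmax_r].
  apply gevrey_le_excess; [lra|assumption].
Qed.

Theorem theorem1p2 (sigma : R) (u0 : nat -> C) (u : R -> nat -> C) :
  0 < sigma ->
  in_Gevrey sigma u0 ->
  szego_solution u0 u ->
  exists lambda C0 : R, 0 < lambda /\ 0 < C0 /\
    forall t : R,
      in_Gevrey (sigma * exp (- lambda * Rabs t)) (u t) /\
      Gevrey_norm (sigma * exp (- lambda * Rabs t)) (u t) <= C0.
Proof.
  intros Hs HG Hsol.
  assert (Hpos : forall r (a : nat -> C) k, 0 <= exp (r * INR k) * Cmod (a k))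
    by (intros; apply Rmult_le_pos; [left; apply exp_pos|apply Cmod_ge_0]).
  assert (HG0 : gevrey_le sigma (Gevrey_norm sigma u0) (u 0)).
  { destruct Hsol as [-> _]. intros m. apply Sum_le_Series; [apply Hpos|exact HG]. }
  destruct (solution_flow u0 u Hsol) as [d Hflow].
  destruct (gevrey_forward sigma (Gevrey_norm sigma u0) Hs) as (l & C1 & Hl & HC1 & H).
  exists l, C1. split; [assumption|]. split; [assumption|]. intros t.
  apply series_of_bounded; [apply Hpos|].
  destruct (Rle_lt_dec 0 t) as [Ht|Ht].
  - rewrite Rabs_pos_eq by assumption. replace (- l * t) with (- (l * t)) by ring.
    now apply (H u d).
  - rewrite Rabs_left by assumption. replace (- l * - t) with (- (l * - t)) by ring.
    intros m.
    (* Conjugation leaves all moduli unchanged, so the reflected flow starts with the same Gevrey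
       bound and the forward estimate at -t applies. *)
    pose proof (H _ _ (flow_reflect u d Hflow)) as Hr.
    assert (Hr0 : gevrey_le sigma (Gevrey_norm sigma u0) (fun k => Cconj (u (- 0) k))).
    { intros n. rewrite Ropp_0. eapply Rle_trans; [|apply (HG0 n)].
      apply Sum_le; intros k _. rewrite Cmod_conj. lra. }
    specialize (Hr Hr0 (- t) ltac:(lra) m). cbv beta in Hr. rewrite Ropp_involutive in Hr.
    eapply Rle_trans; [|exact Hr].
    apply Sum_le; intros k _. rewrite Cmod_conj. lra.
Qed.
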